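(* Let $\alpha\in[0,\tfrac12)$ and $\zeta=\zeta(\alpha)=1-2(2^\alpha-1)$. There exist $\theta_0=\theta_0(\alpha)>0$, $\beta_0=\beta_0(\alpha)$ and constants $c_0(\alpha),c_1(\alpha),c_2(\alpha)>0$ such that for all $0<\theta\le\theta_0$ and all $\beta>\beta_0$ with $$\beta\ge \frac{\zeta}{2^8\theta^2},$$ the following holds. (i) If $0<\alpha<\tfrac12$, set $g(\theta)=\left(\log\frac1\theta\right)\left(\log\log\frac1\theta\right)$ and let $V\subset\mathbb Z$ be an interval centered at the origin with $$\mathrm{diam}(V)=c_0(\alpha)\,e^{g(\theta)}\left(\frac1\theta\right)^{\frac{2}{1-2\alpha}}.$$ Then there is an event of $\mathbb P$-probability at least $1-e^{-g(\theta)}$ on which the $\mu$-probability of the set of configurations $\sigma$ whose runs $(\mathcal L_j)_{b_V\le j\le e_V}$ all satisfy $$c_1(\alpha)\left(\log\frac1\theta\right)^{-\frac{2}{1-2\alpha}}\left(\log\log\frac1\theta\right)^{-\frac{1}{1-2\alpha}}\le \theta^{\frac{2}{1-2\alpha}}\,|\mathcal L_j|\le c_2(\alpha)\left(\log\frac1\theta\right)\left(\log\log\frac1\theta\right)$$ is at least $1-e^{-g(\theta)}$. (ii) If $\alpha=0$, set $\hat g(\theta)=\log\left(\frac{\log(1/\theta)}{\theta}\right)$ and let $\hat V\subset\mathbb Z$ be an interval centered at the origin with $\mathrm{diam}(\hat V)=c_0(0)\,e^{\hat g(\theta)}\theta^{-2}$. Then there is an event of $\mathbb P$-probability at least $1-e^{-\hat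 g(\theta)}$ on which the $\mu$-probability of the set of configurations whose runs $(\mathcal L_j)_{b_{\hat V}\le j\le e_{\hat V}}$ all satisfy $$c_1(0)\le \theta^2|\mathcal L_j|\le c_2(0)\left(\log\frac1\theta\right)^3$$ is at least $1-e^{-\hat g(\theta)}$.
   Context: Random field Ising chain. $(\Omega,\mathcal A,\mathbb P)$ is a probability space carrying i.i.d. random variables $h=(h_i)_{i\in\mathbb Z}$ with $\mathbb P[h_i=1]=\mathbb P[h_i=-1]=\tfrac12$. Spin configurations are $\sigma\in\mathcal S=\{-1,+1\}^{\mathbb Z}$. The pair interaction is $J(1)$, a fixed constant assumed large ($J(1)\gg1$), and $J(n)=n^{-2+\alpha}$ for $n>1$. For finite $\Lambda\subset\mathbb Z$, $\theta>0$, and $\eta\in\mathcal S$, $$H^\eta(\sigma_\Lambda)=\tfrac12\sum_{(i,j)\in\Lambda\times\Lambda}J(|i-j|)(1-\sigma_i\sigma_j)-\theta\sum_{i\in\Lambda}h_i\sigma_i+\sum_{i\in\Lambda}\sum_{j\notin\Lambda}J(|i-j|)(1-\sigma_i\eta_j),$$ and $\mu^\eta_\Lambda(\sigma_\Lambda)=e^{-\beta H^\eta(\sigma_\Lambda)}/Z^\eta_\Lambda$ at inverse temperature $\beta>0$. For $\alpha\in[0,\tfrac12]$, for $\mathbb P$-a.e. realization of $h$, the infinite-volume limits of $\mu^{+}_\Lambda$ and $\mu^-_\Lambda$ (boundary conditions all $+1$, all $-1$) coincide; this unique infinite-volume Gibbs measure is denoted $\mu$ (a random measure depending on $h$). Runs: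 a run is a maximal set of consecutive sites on which $\sigma$ is constant. Given $\sigma$, let $\mathcal L_1$ be the run containing the origin, $\mathcal L_2$ the run immediately to its right, $\mathcal L_0$ the one immediately to its left, and so on, giving the sequence $(\mathcal L_j)_{j\in\mathbb Z}$. For an interval $V\subset\mathbb Z$, $e_V=\sup\{j:\mathcal L_j\subset V\}$ and $b_V=\inf\{j:\mathcal L_j\subset V\}$. *)

(* Defs.v *)
From HB Require Import structures.
From mathcomp Require Import all_boot all_order all_algebra.
From mathcomp Require Import all_classical all_reals all_analysis.
Set Implicit Arguments. Unset Strict Implicit. Unset Printing Implicit Defensive.
Import Order.TTheory GRing.Theory Num.Theory.
Import numFieldNormedType.Exports.
Local Open Scope classical_set_scope.
Local Open Scope ring_scope.

Section RFIM.
Variable R : realType.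

(** Pair interaction: J(1) = J1, J(n) = n^(-2+alpha) for n > 1; J(0) is
    irrelevant (it multiplies 1 - sigma_i sigma_i = 0), set to 0. *)
Definition Jint (alpha J1 : R) (n : nat) : R :=
  if n == 0%N then 0 else if n == 1%N then J1 else (n%:R) `^ (alpha - 2).

Definition spin (b : bool) : R := if b then 1 else -1.

(** Finite volume Lambda_n = {-n,...,n}; its sites are indexed by 'I_(2n+1),
    index i <-> integer site i - n. *)
Notation Lam n := 'I_(n.*2).+1.

Definition site (n : nat) (i : Lam n) : int := (i%:Z - n%:Z)%R.

Definition inLam (n : nat) (z : int) : bool := (- (n%:Z) <= z) && (z <= n%:Z).

Definition ext (n : nat) (eta : int -> bool) (s : {ffun Lam n -> bool}) : int -> bool :=
  fun z => if inLam n z then s (inord (absz (z + n%:Z)%R)) else eta z.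

(** H^eta(sigma_Lambda); the sum over j outside Lambda_n is split into the
    two series over j = n+1+k and j = -n-1-k, k >= 0. *)
Definition Hfin (alpha J1 theta : R) (h : int -> R) (n : nat) (eta : int -> bool)
    (s : {ffun Lam n -> bool}) : R :=
  2^-1 * (\sum_(i : Lam n) \sum_(j : Lam n)
            Jint alpha J1 (absz (site i - site j)%R) * (1 - spin (s i) * spin (s j)))
  - theta * (\sum_(i : Lam n) h (site i) * spin (s i))
  + \sum_(i : Lam n)
      (limn (fun N : nat => \sum_(0 <= k < N)
          (Jint alpha J1 (absz (site i - (n%:Z + 1 + k%:Z))%R)
           * (1 - spin (s i) * spin (eta (n%:Z + 1 + k%:Z)))))
     + limn (fun N : nat => \sum_(0 <= k < N)
          (Jint alpha J1 (absz (site i - (- n%:Z - 1 - k%:Z))%R)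
           * (1 - spin (s i) * spin (eta (- n%:Z - 1 - k%:Z)))))).

Definition gibbs_prob (alpha J1 theta beta : R) (h : int -> R) (n : nat)
    (eta : int -> bool) (E : (int -> bool) -> Prop) : R :=
  (\sum_(s : {ffun Lam n -> bool} | `[< E (ext eta s) >])
      expR (- beta * Hfin alpha J1 theta h eta s))
  / (\sum_(s : {ffun Lam n -> bool}) expR (- beta * Hfin alpha J1 theta h eta s)).

Definition plus_bc : int -> bool := fun _ => true.

Definition finite_run (sigma : int -> bool) (a b : int) : Prop :=
  [/\ a <= b, (forall z : int, a <= z <= b -> sigma z = sigma a),
      sigma (a - 1) != sigma a & sigma (b + 1) != sigma b].

Definition centered_interval (D : R) : set int := [set z | `|(z%:~R : R)| <= D / 2].

(** every run L_j, b_V <= j <= e_V (i.e. every run contained in V) satisfies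
    lo <= scale * |L_j| <= hi *)
Definition runs_ok (D lo hi scale : R) (sigma : int -> bool) : Prop :=
  forall a b : int, finite_run sigma a b ->
    (forall z : int, a <= z <= b -> centered_interval D z) ->
    lo <= scale * ((b - a + 1)%:~R) <= hi.

Definition iid_sym_signs (d : measure_display) (T : measurableType d)
    (P : probability T R) (h : int -> T -> R) : Prop :=
  [/\ (forall i, measurable_fun [set: T] (h i)),
      (forall i, P [set w | h i w = 1] = (2^-1)%:E /\ P [set w | h i w = -1] = (2^-1)%:E)
    & (forall (F : seq int) (v : int -> R), uniq F ->
        P (\bigcap_(i in [set` F]) [set w | h i w = v i])
        = (\prod_(i <- F) P [set w | h i w = v i])%E)].

End RFIM.

(* Main.v *)
Require Import Defs.
From HB Require Import structures.
From mathcomp Require Import all_boot all_order all_algebra.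
From mathcomp Require Import all_classical all_reals all_analysis.
From mathcomp Require Import ring lra zify.
Set Implicit Arguments. Unset Strict Implicit. Unset Printing Implicit Defensive.
Import Order.TTheory GRing.Theory Num.Theory.
Import numFieldNormedType.Exports.
Local Open Scope classical_set_scope.
Local Open Scope ring_scope.

(** Since beta is at least of order theta^(-2), entropy plays no role: it suffices to exhibit, for
    every configuration with a bad run, an interval whose spin flip lowers the energy by at least 2.
    The set of configurations for which a given flip does so has Gibbs probability at most
    exp(-2 beta), and there are few enough intervals for a union bound.

    Short runs: from a short run one reaches, by moving repeatedly to a shorter neighbour, a run of
    length L not longer than its two neighbours.  Flipping it gains the interaction with the sites
    at distance at most L and loses at most that with the farther ones, a net gain of at least
    const + zeta L^alpha / (alpha (1 - alpha)) (resp. const + log L when alpha = 0); by a Chernoff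
    bound the field does not compensate this on short intervals.

    Long runs: by a second and fourth moment estimate, a block of length ell has, with probability
    at least 1/10, a field sum at least sqrt ell / 2 of a prescribed sign; on a long run one of many
    independent blocks does, and flipping it costs only order ell^alpha (resp. log ell).

    The infinite-volume limit of a local event exists because, by the FKG inequality, the
    probabilities that all spins of a given set are + decrease with the volume under + boundary
    conditions. *)

(** * Power sums and interaction energies *)

(** The scale [theta^(-2/(1-2 alpha))] is where the typical field energy [theta * sqrt L] of an
    interval balances its interaction [L^alpha] with the outside; the logarithms in the two bounds
    on the runs pay for making this uniform over all intervals near [V]. All errors are of the form
    [exp (- x)] times a power of the largest length scale. The exponent [x] is a large multiple of
    [log(1/theta) log log(1/theta)], or of [log(1/theta)] when [alpha = 0], which beats that power.
    The lower bound on [beta] grows like [theta^(-2)], far above [x], so the thermal error is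
    covered by the same estimate. The Hamiltonian contains infinite series. It is therefore written
    as a limit of energies of finite boxes with free boundary; flips are computed there by finite
    sums and the inequalities pass to the limit. *)

Section PowerSums.
Variable R : realType.
Implicit Types (a b x y : R).

(** Convexity. With [y = x e^s] it becomes [1 + b (e^s - 1) <= e^(s b)], which follows from
    [1 + t <= e^t] at [t = s b] and at [t = s], the latter multiplied by [b <= 0]. *)
Lemma powR_tangent_le0 b x y : b <= 0 -> 0 < x -> 0 < y ->
  x `^ b + b * x `^ (b - 1) * (y - x) <= y `^ b.
Proof.
move=> b0 x0 y0.
have [s ys] : exists s, y = x * expR s.
  by exists (ln y - ln x); rewrite expRB !lnK ?posrE // mulrC divfK // gt_eqF.
have xb : x `^ (b - 1) * x = x `^ b.
  by rewrite -{2}(powRr1 (ltW x0)) -powRD ?subrK // (gt_eqF x0) implybT.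
have -> : b * x `^ (b - 1) * (y - x) = x `^ b * (b * (expR s - 1)).
  by rewrite -xb ys; ring.
have -> : y `^ b = x `^ b * expR (s * b).
  by rewrite ys powRM ?expR_ge0 ?(ltW x0) // expRM.
have px : 0 < x `^ b by rewrite powR_gt0.
rewrite -{1}[x `^ b]mulr1 -mulrDr ler_pM2l //.
have h1 := expR_ge1Dx (s * b); have h2 := expR_ge1Dx s.
by apply: le_trans h1; nra.
Qed.

Lemma powR_tangent_le1 a x y : 0 <= a <= 1 -> 0 < x -> 0 < y ->
  y `^ a <= x `^ a + a * x `^ (a - 1) * (y - x).
Proof.
move=> /andP[a0 a1] x0 y0.
have [s ys] : exists s, y = x * expR s.
  by exists (ln y - ln x); rewrite expRB !lnK ?posrE // mulrC divfK // gt_eqF.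
have xb : x `^ (a - 1) * x = x `^ a.
  by rewrite -{2}(powRr1 (ltW x0)) -powRD ?subrK // (gt_eqF x0) implybT.
have -> : a * x `^ (a - 1) * (y - x) = x `^ a * (a * (expR s - 1)).
  by rewrite -xb ys; ring.
have -> : y `^ a = x `^ a * expR (s * a).
  by rewrite ys powRM ?expR_ge0 ?(ltW x0) // expRM.
have px : 0 < x `^ a by rewrite powR_gt0.
rewrite -{2}[x `^ a]mulr1 -mulrDr ler_pM2l //.
(* Tangent of the exponential at [s a], evaluated at [s] here and at [0] in [h2]; with weights [a]
   and [1 - a] the terms linear in [s] cancel. *)
have h1 : expR (s * a) * (1 + (1 - a) * s) <= expR s.
  have -> : expR s = expR (s * a) * expR ((1 - a) * s).
    by rewrite -expRD; congr expR; ring.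
  by rewrite ler_pM2l ?expR_gt0 // expR_ge1Dx.
have h2 : expR (s * a) * (1 - a * s) <= 1.
  have -> : 1 - a * s = 1 + - (s * a) by ring.
  rewrite [leRHS](_ : _ = expR (s * a) * expR (- (s * a))).
    by rewrite ler_pM2l ?expR_gt0 // expR_ge1Dx.
  by rewrite -expRD subrr expR0.
have h3 : a * (expR (s * a) * (1 + (1 - a) * s)) <= a * expR s by rewrite ler_wpM2l.
have h4 : (1 - a) * (expR (s * a) * (1 - a * s)) <= (1 - a) * 1.
  by rewrite ler_wpM2l // subr_ge0.
have -> : expR (s * a) = a * (expR (s * a) * (1 + (1 - a) * s)) +
   (1 - a) * (expR (s * a) * (1 - a * s)) by ring.
by apply: le_trans (lerD h3 h4) _; lra.
Qed.

(* An antiderivative of [x `^ (alpha - 1)], up to a constant. *)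
Definition antideriv (alpha x : R) : R :=
  if alpha == 0 then ln x else x `^ alpha / alpha.

Variable alpha : R.
Hypothesis alpha01 : 0 <= alpha < 1.
Let a1 : 0 < 1 - alpha. Proof. by move/andP: alpha01 => [_]; rewrite subr_gt0. Qed.

(** Concavity of [antideriv]; at consecutive integers it compares a term of a power sum with an
    increment, so that the sums telescope. *)
Lemma antideriv_tangent x y : 0 < x -> 0 < y ->
  antideriv alpha y <= antideriv alpha x + x `^ (alpha - 1) * (y - x).
Proof.
move=> x0 y0; rewrite /antideriv; case: eqP => [->|/eqP an0].
  rewrite sub0r powR_inv1 ?(ltW x0) //.
  have -> : ln y = ln x + ln (y / x).
    by rewrite lnM ?posrE ?invr_gt0 // lnV ?posrE //; ring.
  rewrite lerD2l.
  have -> : x^-1 * (y - x) = y / x - 1.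
    by rewrite mulrBr mulVf ?gt_eqF // mulrC.
  have yx : 0 < y / x by rewrite divr_gt0.
  have := expR_ge1Dx (ln (y / x)); rewrite lnK ?posrE // => h; lra.
have ap : 0 < alpha by rewrite lt_neqAle eq_sym an0; case/andP: alpha01.
rewrite ler_pdivrMr // mulrDl divfK //.
apply: le_trans (@powR_tangent_le1 alpha x y _ x0 y0) _.
  by case/andP: alpha01 => -> /ltW ->.
by rewrite le_eqVlt; apply/orP; left; apply/eqP; ring.
Qed.

Lemma antideriv_homo x y : 0 < x -> x <= y -> antideriv alpha x <= antideriv alpha y.
Proof.
move=> x0 xy; have y0 : 0 < y by apply: lt_le_trans xy.
apply: le_trans (antideriv_tangent y0 x0) _.
rewrite gerDl; apply: mulr_ge0_le0; first exact: powR_ge0.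
by rewrite subr_le0.
Qed.

Lemma antideriv1_ge0 : 0 <= antideriv alpha 1.
Proof.
rewrite /antideriv; case: eqP => _; first by rewrite ln1.
by rewrite powR1 div1r invr_ge0; case/andP: alpha01.
Qed.

Lemma sum_powR_ge (L : nat) :
  antideriv alpha L.+1%:R - antideriv alpha 1 <=
    \sum_(0 <= u < L) u.+1%:R `^ (alpha - 1).
Proof.
elim: L => [|L IH]; first by rewrite big_nil subrr.
rewrite big_nat_recr //=.
have := @antideriv_tangent L.+1%:R L.+2%:R (ltr0Sn _ _) (ltr0Sn _ _).
by rewrite -[L.+2]addn1 natrD addrAC subrr add0r mulr1 -natrD addn1; lra.
Qed.

Lemma sum_powR_le (m L : nat) : (0 < m)%N ->
  \sum_(0 <= u < L) (u + m)%:R `^ (alpha - 1) <=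
    1 + antideriv alpha (m + L)%:R - antideriv alpha m%:R.
Proof.
move=> m0.
have m1 : m%:R `^ (alpha - 1) <= (1 : R).
  rewrite -[leRHS](powRr0 m%:R); apply: ler_powR; first by rewrite ler1n.
  by case/andP: alpha01 => _ /ltW; rewrite subr_le0.
(* One term more than required: the first is absorbed by the constant 1, each later one by an
   increment of [antideriv]. *)
suff H : \sum_(0 <= u < L.+1) (u + m)%:R `^ (alpha - 1) <=
    1 + antideriv alpha (m + L)%:R - antideriv alpha m%:R.
  apply: le_trans H; rewrite big_nat_recr //= lerDl; exact: powR_ge0.
elim: L => [|L IH].
  by rewrite big_nat1 add0n addn0; lra.
rewrite big_nat_recr //=.
have := @antideriv_tangent (m + L).+1%:R (m + L)%:R (ltr0Sn _ _).
rewrite ltr0n addn_gt0 m0 /= => /(_ isT).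
have -> : (L.+1 + m = (m + L).+1)%N by lia.
have -> : (m + L.+1 = (m + L).+1)%N by lia.
have -> : (m + L)%:R - (m + L).+1%:R = -1 :> R by rewrite -natr1; ring.
by lra.
Qed.

Let b := alpha - 1.
Let b0 : b <= 0. Proof. by rewrite subr_le0; case/andP: alpha01 => _ /ltW. Qed.

Lemma powR_diff_ge (k : nat) : (0 < k)%N ->
  (k%:R `^ b - k.+1%:R `^ b) / (1 - alpha) <= k%:R `^ (alpha - 2).
Proof.
move=> k0; rewrite ler_pdivrMr //.
have := @powR_tangent_le0 b k%:R k.+1%:R.
have -> : k.+1%:R - k%:R = 1 :> R by rewrite -natr1; ring.
rewrite (_ : b - 1 = alpha - 2); last by rewrite /b; ring.
have kp : (0 : R) < k%:R by rewrite ltr0n.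
by move=> /(_ b0 kp (ltr0Sn _ _)); rewrite /b; lra.
Qed.

Lemma powR_diff_le (k : nat) : (0 < k)%N ->
  k.+1%:R `^ (alpha - 2) <= (k%:R `^ b - k.+1%:R `^ b) / (1 - alpha).
Proof.
move=> k0; rewrite ler_pdivlMr //.
have := @powR_tangent_le0 b k.+1%:R k%:R.
have -> : k%:R - k.+1%:R = -1 :> R by rewrite -natr1; ring.
rewrite (_ : b - 1 = alpha - 2); last by rewrite /b; ring.
have kp : (0 : R) < k%:R by rewrite ltr0n.
by move=> /(_ b0 (ltr0Sn _ _) kp); rewrite /b; lra.
Qed.

Variable J1 : R.
Local Notation J := (Jint alpha J1).

Lemma JintSS k : J k.+2 = k.+2%:R `^ (alpha - 2).
Proof. by []. Qed.

Lemma Jint_ge0 : 0 <= J1 -> forall k, 0 <= J k.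
Proof. by move=> ? [|[|k]] //=; exact: powR_ge0. Qed.

Lemma sum_Jint_le m q : (0 < m)%N ->
  \sum_(0 <= w < q) J (m + w).+1 <= m%:R `^ b / (1 - alpha).
Proof.
case: m => // m _.
suff H : \sum_(0 <= w < q) J (m.+1 + w).+1 <=
    (m.+1%:R `^ b - (m.+1 + q)%:R `^ b) / (1 - alpha).
  apply: le_trans H _; rewrite ler_pdivrMr // divfK ?gt_eqF //.
  by rewrite gerBl powR_ge0.
elim: q => [|q IH]; first by rewrite big_nil addn0 subrr mul0r.
rewrite big_nat_recr //=.
have := @powR_diff_le (m.+1 + q) isT; rewrite addSn JintSS => h.
have := lerD IH h; rewrite -mulrDl addrA addrNK addSn => h1.
by move: h1; rewrite addnS.
Qed.

(** The first summand corrects the power formula at distance 1, where it would give 1 instead of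
    [J1]; that distance occurs only for [m = 0] and [q > 0]. This is how a large [J1] becomes a
    gain. *)
Lemma sum_Jint_ge m q :
  (m == 0)%:R * (J1 - 1) * (q != 0)%:R
    + (m.+1%:R `^ b - (m.+1 + q)%:R `^ b) / (1 - alpha) <=
  \sum_(0 <= w < q) J (m + w).+1.
Proof.
elim: q => [|q IH]; first by rewrite big_nil addn0 subrr mul0r eqxx mulr0 addr0.
rewrite big_nat_recr //=.
have := @powR_diff_ge (m.+1 + q) isT => h.
have e1 : (m + q).+1%:R `^ (alpha - 2) + (m == 0)%:R * (J1 - 1) * (q == 0)%:R
     = J (m + q).+1.
  case: m {IH h} => [|m]; last by rewrite /= addSn mul0r mul0r addr0.
  case: q => [|q]; last by rewrite /= add0n mulr0 addr0.
  by rewrite /= addn0 /Jint /= powR1; ring.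
rewrite -e1; move: h IH; rewrite addnS !addSn !mulrBl.
by case: (q == 0) => /=; rewrite ?mulr0 ?mulr1; lra.
Qed.

(** Interaction of an interval of length [L] with the [q] sites next to it on one side: [u] is the
    depth inside the interval, [w] the gap outside, and [u + w + 1] the distance. *)
Definition Cut (J : nat -> R) (L q : nat) : R :=
  \sum_(0 <= u < L) \sum_(0 <= w < q) J (u + w).+1.

Lemma Cut_le L q : 0 <= J1 -> (0 < L)%N ->
  Cut J L q <= J1 + (3 + antideriv alpha L%:R) / (1 - alpha).
Proof.
move=> J10; case: L => // L _; rewrite /Cut big_nat_recl //=.
(* The boundary row [u = 0] contains [J1] and is bounded apart; the other rows only meet distances
   at least 2. *)
have h0 : \sum_(0 <= w < q) J (0 + w).+1 <= J1 + 1 / (1 - alpha).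
  case: q => [|q]; first by rewrite big_nil addr_ge0 // divr_ge0 // ltW.
  rewrite big_nat_recl //= addn0 lerD2l.
  by have := @sum_Jint_le 1 q isT; rewrite powR1.
have h1 : \sum_(0 <= u < L) \sum_(0 <= w < q) J (u.+1 + w).+1 <=
   (1 + antideriv alpha L.+1%:R) / (1 - alpha).
  apply: (@le_trans _ _ ((\sum_(0 <= u < L) (u + 1)%:R `^ b) / (1 - alpha))).
    rewrite mulr_suml; apply: ler_sum => u _; rewrite addn1; exact: sum_Jint_le.
  rewrite ler_pM2r ?invr_gt0 //; have := @sum_powR_le 1 L isT.
  rewrite add1n => h; apply: le_trans h _; rewrite gerBl; exact: antideriv1_ge0.
apply: le_trans (lerD h0 h1) _; rewrite -addrA -mulrDl lerD2l.
by rewrite ler_pM2r ?invr_gt0 //; lra.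
Qed.

(** In row [u], up to the factor [1/(1 - alpha)], far sites cost at most [(u+L)^(alpha-1)] and near
    ones gain at least [(u+1)^(alpha-1) - (u+1+L)^(alpha-1)]. Summed over rows this is
    [2 F(2L) - 3 F(L)] plus constants, with [F = antideriv]. For [F(x) = x^alpha / alpha] it equals
    [- zeta L^alpha / alpha]: here [zeta = 3 - 2 * 2^alpha] originates. *)
Lemma Cut_near_far L q : (0 < L)%N -> (L <= q)%N ->
  Cut J L q - 2 * Cut J L L <= - (J1 - 1) +
    (2 + antideriv alpha 1 + 2 * antideriv alpha (2 * L%:R) - 3 * antideriv alpha L%:R)
      / (1 - alpha).
Proof.
move=> L0 Lq; rewrite /Cut mulr_sumr -sumrB.
have step u : \sum_(0 <= w < q) J (u + w).+1 - 2 * \sum_(0 <= w < L) J (u + w).+1 <=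
   (u == 0)%:R * (1 - J1) + (2 * (u + L)%:R `^ b - u.+1%:R `^ b) / (1 - alpha).
  rewrite (big_cat_nat (n := L)) //=.
  have near := sum_Jint_ge u L; rewrite -lt0n L0 mulr1 in near.
  have far : \sum_(L <= w < q) J (u + w).+1 <= (u + L)%:R `^ b / (1 - alpha).
    rewrite -{1}[L]add0n big_addn.
    have uL : (0 < u + L)%N by rewrite addn_gt0 L0 orbT.
    have := @sum_Jint_le (u + L) (q - L) uL.
    apply: le_trans; rewrite le_eqVlt; apply/orP; left; apply/eqP.
    by apply: eq_bigr => w _; rewrite addnCA addnC.
  have mon : (u.+1 + L)%:R `^ b <= (u + L)%:R `^ b.
    have uL0 : (0 < u + L)%N by rewrite addn_gt0 L0 orbT.
    have := le_trans (powR_ge0 _ _) (powR_diff_le uL0).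
    by rewrite pmulr_lge0 ?invr_gt0 // subr_ge0 addSn.
  have mon' : (u.+1 + L)%:R `^ b / (1 - alpha) <= (u + L)%:R `^ b / (1 - alpha).
    by rewrite ler_pM2r ?invr_gt0.
  move: near far; rewrite !mulrBl => near far; nra.
apply: le_trans (ler_sum_nat (fun u _ => step u)) _.
rewrite big_split /= -mulr_suml -mulr_suml sumrB -mulr_sumr.
apply: lerD.
  case: L L0 {Lq step} => // L _; rewrite big_nat_recl //= big1 ?addr0; last by [].
  by rewrite mul1r; lra.
rewrite ler_pM2r ?invr_gt0 //.
have h1 := @sum_powR_le L L L0; have h2 := @sum_powR_ge L.
have h3 : antideriv alpha L%:R <= antideriv alpha L.+1%:R.
  by apply: antideriv_homo; rewrite ?ltr0n // ler_nat.
move: h1; rewrite -/b addnn -mul2n natrM => h1; lra.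
Qed.

End PowerSums.

(** * The FKG inequality *)

Section FKG.
Variables (R : realType) (I : finType).
Local Notation X := {ffun I -> bool}.
Implicit Types (s t : X) (F : X -> R).

Definition upd (x : I) (b : bool) s : X := [ffun i => if i == x then b else s i].
Definition joinf s t : X := [ffun i => s i || t i].
Definition meetf s t : X := [ffun i => s i && t i].

Lemma sum_flip (x : I) F : \sum_(s : X) F (upd x (~~ s x) s) = \sum_s F s.
Proof.
symmetry; apply: (reindex_inj (h := fun s : X => upd x (~~ s x) s)).
apply: (can_inj (g := fun s : X => upd x (~~ s x) s)) => s.
apply/ffunP => i; rewrite !ffunE eqxx negbK.
by case: eqP => [->|].
Qed.

(** The four functions theorem on one coordinate. Put [P = c1 d0], [X = a0 b1], [Y = a1 b0]. As [X]
    and [Y] are at most [P], [(P - X)(P - Y) >= 0] gives [P (X + Y) <= P^2 + X Y], and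
    [X Y = (a0 b0)(a1 b1) <= P (c0 d1)]. *)
Lemma four_real_ineq (a0 a1 b0 b1 c0 c1 d0 d1 : R) :
  0 <= a0 -> 0 <= a1 -> 0 <= b0 -> 0 <= b1 ->
  0 <= c0 -> 0 <= c1 -> 0 <= d0 -> 0 <= d1 ->
  a0 * b0 <= c0 * d0 -> a1 * b1 <= c1 * d1 ->
  a0 * b1 <= c1 * d0 -> a1 * b0 <= c1 * d0 ->
  (a1 + a0) * (b1 + b0) <= (c1 + c0) * (d1 + d0).
Proof.
move=> a00 a10 b00 b10 c00 c10 d00 d10 h00 h11 h01 h10.
have [cd0|cdp] := lerP (c1 * d0) 0.
  have e1 : a0 * b1 = 0.
    by apply/eqP; rewrite eq_le (le_trans h01 cd0) mulr_ge0.
  have e2 : a1 * b0 = 0.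
    by apply/eqP; rewrite eq_le (le_trans h10 cd0) mulr_ge0.
  have := mulr_ge0 c10 d00; have := mulr_ge0 c00 d10; nra.
rewrite -(ler_pM2r cdp).
have h1 : (a0 * b0) * (a1 * b1) <= (c0 * d0) * (c1 * d1).
  by apply: ler_pM => //; apply: mulr_ge0.
have h2 : 0 <= (c1 * d0 - a0 * b1) * (c1 * d0 - a1 * b0).
  by apply: mulr_ge0; rewrite subr_ge0.
have h3 : (a1 * b1) * (c1 * d0) <= (c1 * d1) * (c1 * d0).
  by rewrite ler_pM2r.
have h4 : (a0 * b0) * (c1 * d0) <= (c0 * d0) * (c1 * d0).
  by rewrite ler_pM2r.
nra.
Qed.

(** Sums out coordinate [x] while staying on the same cube; the price is a factor 2 in the total
    sum. *)
Definition marg (x : I) F : X -> R := fun s => F (upd x true s) + F (upd x false s).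

Lemma sum_marg x F : \sum_s marg x F s = 2 * \sum_s F s.
Proof.
rewrite mulr_natl mulr2n -{2}(sum_flip x F) -big_split /=; apply: eq_bigr => s _.
have u b : s x = b -> upd x b s = s.
  by move=> <-; apply/ffunP => i; rewrite !ffunE; case: eqP => [->|].
by rewrite /marg; case E : (s x) => /=; rewrite (u _ E) // addrC.
Qed.

Definition margs (r : seq I) F : X -> R := foldr marg F r.

Lemma sum_margs r F : \sum_s margs r F s = 2 ^+ size r * \sum_s F s.
Proof.
elim: r => [|x r IH] /=; first by rewrite expr0 mul1r.
by rewrite sum_marg IH exprS mulrA.
Qed.

Lemma margs_upd r F x b s : x \in r -> margs r F (upd x b s) = margs r F s.
Proof.
elim: r s => [|y r IH] //= s; rewrite inE /marg.
have [->|nxy /= xr] := eqVneq x y.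
  have u c : upd y c (upd y b s) = upd y c s.
    by apply/ffunP => i; rewrite !ffunE; case: eqP.
  by rewrite !u.
have u c : upd y c (upd x b s) = upd x b (upd y c s).
  apply/ffunP => i; rewrite !ffunE; have [->|//] := eqVneq i y.
  by rewrite eq_sym (negbTE nxy).
by rewrite !u !IH.
Qed.

(** The coordinates of [s] are replaced by those of [t] one at a time, and a function does not see a
    coordinate that has been summed out. *)
Lemma margs_const F s t : margs (enum I) F s = margs (enum I) F t.
Proof.
pose mix (r : seq I) := [ffun i => if i \in r then t i else s i] : X.
have H (r : seq I) : margs (enum I) F (mix r) = margs (enum I) F s.
  elim: r => [|x r IH]; first by congr margs; apply/ffunP => i; rewrite ffunE in_nil.
  rewrite -IH -(@margs_upd _ _ x (t x) (mix r)) ?mem_enum //.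
  congr margs; apply/ffunP => i; rewrite !ffunE inE.
  by have [->|] := eqVneq i x.
rewrite -(H (enum I)); congr margs; apply/ffunP => i.
by rewrite ffunE mem_enum.
Qed.

Lemma margs_enum F s : margs (enum I) F s = \sum_t F t.
Proof.
have h := sum_margs (enum I) F.
rewrite (eq_bigr (fun=> margs (enum I) F s)) in h; last first.
  by move=> t _; exact: margs_const.
move: h; rewrite sumr_const card_ffun card_bool -cardE -[LHS]mulr_natl natrX.
by apply: mulfI; rewrite expf_neq0 // pnatr_eq0.
Qed.

(** Ahlswede-Daykin. The pointwise hypothesis survives summing out a coordinate, by
    [four_real_ineq]; when all are summed out, each function is constant and equal to its total
    sum. *)
Lemma four_functions (a b c d : X -> R) :
  (forall s, 0 <= a s) -> (forall s, 0 <= b s) ->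
  (forall s, 0 <= c s) -> (forall s, 0 <= d s) ->
  (forall s t, a s * b t <= c (joinf s t) * d (meetf s t)) ->
  (\sum_s a s) * (\sum_s b s) <= (\sum_s c s) * (\sum_s d s).
Proof.
move=> a0 b0 c0 d0 H.
have margs_ge0 F r : (forall s, 0 <= F s) -> forall s, 0 <= margs r F s.
  move=> F0; elim: r => [|x r IH] s //=; exact: addr_ge0.
have ind r s t :
    margs r a s * margs r b t <= margs r c (joinf s t) * margs r d (meetf s t).
  elim: r s t => [|x r IH] s t //=.
  have uj e f : joinf (upd x e s) (upd x f t) = upd x (e || f) (joinf s t).
    by apply/ffunP => i; rewrite !ffunE; case: eqP.
  have um e f : meetf (upd x e s) (upd x f t) = upd x (e && f) (meetf s t).
    by apply/ffunP => i; rewrite !ffunE; case: eqP.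
  apply: four_real_ineq; rewrite ?margs_ge0 //.
  - by have := IH (upd x false s) (upd x false t); rewrite uj um.
  - by have := IH (upd x true s) (upd x true t); rewrite uj um.
  - by have := IH (upd x false s) (upd x true t); rewrite uj um.
  - by have := IH (upd x true s) (upd x false t); rewrite uj um.
pose s0 : X := [ffun=> true].
rewrite -!(margs_enum _ s0) (margs_const c _ (joinf s0 s0)).
by rewrite (margs_const d _ (meetf s0 s0)).
Qed.

(** The four functions are [W] restricted to [f], to [g], to [f && g], and [W] itself. *)
Lemma FKG (W : X -> R) (f g : pred X) :
  (forall s, 0 <= W s) ->
  (forall s t, W s * W t <= W (joinf s t) * W (meetf s t)) ->
  (forall s t, f s -> f (joinf s t)) -> (forall s t, g t -> g (joinf s t)) ->
  (\sum_(s | f s) W s) * (\sum_(s | g s) W s) <=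
  (\sum_(s | f s && g s) W s) * (\sum_s W s).
Proof.
move=> W0 WW fm gm.
rewrite (big_mkcond f) (big_mkcond g) (big_mkcond (fun s => _ && _)).
apply: four_functions => [s|s|s|//|s t]; [by case: ifP..|].
case: ifP => fs; last by rewrite mul0r mulr_ge0 //; case: ifP.
case: ifP => gt; last by rewrite mulr0 mulr_ge0 //; case: ifP.
by rewrite fm // gm.
Qed.

End FKG.

(** * The Hamiltonian *)

Section IntegerIntervals.

(** Intervals are sequences, so that cutting a box around an interval is a concatenation. *)
Definition zint (a : int) (n : nat) : seq int := [seq a + k%:Z | k <- iota 0 n].
Definition box (n : nat) : seq int := zint (- n%:Z) (n.*2).+1.

Lemma mem_zint a n z : (z \in zint a n) = (a <= z) && (z < a + n%:Z).
Proof.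
apply/mapP/andP => [[k + ->]|[az zn]].
  by rewrite mem_iota => /andP[_ kn]; lia.
exists (absz (z - a)%R); last by lia.
by rewrite mem_iota; lia.
Qed.

Lemma zint_uniq a n : uniq (zint a n).
Proof. by rewrite map_inj_uniq ?iota_uniq // => x y /=; lia. Qed.

Lemma zint_cat a m n : zint a (m + n) = zint a m ++ zint (a + m%:Z) n.
Proof.
rewrite /zint iotaD map_cat; congr (_ ++ _); rewrite add0n -[X in iota X]addn0 iotaDl.
by rewrite -map_comp; apply: eq_map => k /=; lia.
Qed.

Lemma size_zint a n : size (zint a n) = n.
Proof. by rewrite size_map size_iota. Qed.

Lemma mem_box n z : (z \in box n) = (- n%:Z <= z <= n%:Z).
Proof. by rewrite mem_zint; apply/idP/idP; lia. Qed.

Lemma big_zint (R : realType) (a : int) n (f : int -> R) :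
  \sum_(z <- zint a n) f z = \sum_(0 <= k < n) f (a + k%:Z).
Proof. by rewrite big_map /index_iota subn0. Qed.

Lemma big_zint_rev (R : realType) (a : int) n (f : int -> R) :
  \sum_(z <- zint a n) f z = \sum_(0 <= k < n) f (a + n%:Z - 1 - k%:Z).
Proof.
rewrite big_zint big_nat_rev /= [LHS]big_nat [RHS]big_nat.
by apply: eq_bigr => k /andP[_ kn]; congr f; lia.
Qed.

Lemma big_site (R : realType) n (f : int -> R) :
  \sum_(i : 'I_(n.*2).+1) f (site i) = \sum_(z <- box n) f z.
Proof.
rewrite big_zint big_mkord; apply: eq_bigr => i _.
by rewrite /site addrC.
Qed.

Lemma box_split n a L : {subset zint a L <= box n} -> (0 < L)%N ->
  exists p q : nat, [/\ box n = zint (- n%:Z) p ++ zint a L ++ zint (a + L%:Z) q,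
     p%:Z = a + n%:Z & q%:Z = n%:Z + 1 - (a + L%:Z)].
Proof.
move=> sub L0.
have h1 : a \in box n by apply: sub; rewrite mem_zint; lia.
have h2 : a + L%:Z - 1 \in box n by apply: sub; rewrite mem_zint; lia.
rewrite !mem_box in h1 h2.
exists (absz (a + n%:Z)%R), (absz (n%:Z + 1 - (a + L%:Z))%R); split; [|lia|lia].
set p := absz _; set q := absz _.
have ea : a = - n%:Z + p%:Z by rewrite /p; lia.
by rewrite -zint_cat [in zint a]ea -zint_cat /box; congr zint; rewrite /p /q; lia.
Qed.

Local Notation Lam n := 'I_(n.*2).+1.

Lemma ext_site n eta (s : {ffun Lam n -> bool}) i : ext eta s (site i) = s i.
Proof.
rewrite /ext /inLam /site; case: ifP => [_|]; last by have := ltn_ord i; lia.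
congr (s _); apply: val_inj; rewrite /= inordK; first by lia.
by have := ltn_ord i; lia.
Qed.

Lemma site_ex n (z : int) : z \in box n -> exists i : Lam n, site i = z.
Proof.
rewrite mem_box => hz; exists (inord (absz (z + n%:Z)%R)).
by rewrite /site inordK; lia.
Qed.

Lemma ext_out n eta (s : {ffun Lam n -> bool}) z : z \notin box n -> ext eta s z = eta z.
Proof. by rewrite mem_box /ext /inLam => /negbTE ->. Qed.

End IntegerIntervals.

Section Hamiltonian.
Variable R : realType.
Variables (alpha J1 theta : R) (h : int -> R).

Local Notation J := (Jint alpha J1).
Local Notation sp := (spin R).
Local Notation Lam n := 'I_(n.*2).+1.
Local Notation H := (Hfin alpha J1 theta h plus_bc).

(** Free-boundary energy of a box, made of finite sums only; [Hfin] is recovered from it as [M]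
    tends to infinity. *)
Definition Hbox (M : nat) (sg : int -> bool) : R :=
  2^-1 * (\sum_(i <- box M) \sum_(j <- box M) J (absz (i - j)%R) * (1 - sp (sg i) * sp (sg j)))
  - theta * \sum_(i <- box M) h i * sp (sg i).

(** Isolates the pairs that join [B] to its complement, the only ones affected when [B] is
    flipped. *)
Lemma pair_sum_split (A B C : seq int) (g : int -> int -> R) :
  (forall i j, g i j = g j i) ->
  2^-1 * \sum_(i <- A ++ B ++ C) \sum_(j <- A ++ B ++ C) g i j =
  2^-1 * (\sum_(i <- B) \sum_(j <- B) g i j)
  + \sum_(i <- B) (\sum_(j <- A) g i j + \sum_(j <- C) g i j)
  + 2^-1 * \sum_(i <- A ++ C) \sum_(j <- A ++ C) g i j.
Proof.
move=> gs.
have sym X Y : \sum_(i <- X) \sum_(j <- Y) g i j = \sum_(i <- Y) \sum_(j <- X) g i j.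
  rewrite exchange_big /=; apply: eq_bigr => i _; apply: eq_bigr => j _; exact: gs.
rewrite !big_cat /=.
have cat3 X : \sum_(i <- X) \sum_(j <- A ++ B ++ C) g i j =
  \sum_(i <- X) \sum_(j <- A) g i j + (\sum_(i <- X) \sum_(j <- B) g i j
   + \sum_(i <- X) \sum_(j <- C) g i j).
  by rewrite -!big_split; apply: eq_bigr => i _; rewrite !big_cat.
have cat2 X : \sum_(i <- X) \sum_(j <- A ++ C) g i j =
  \sum_(i <- X) \sum_(j <- A) g i j + \sum_(i <- X) \sum_(j <- C) g i j.
  by rewrite -!big_split; apply: eq_bigr => i _; rewrite !big_cat.
rewrite !cat3 !cat2 big_split /= (sym A B) (sym C B).
by field.
Qed.

Lemma cvg_sum_seq (I : Type) (r : seq I) (f : I -> nat -> R) (l : I -> R) :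
  (forall i, f i n @[n --> \oo] --> l i) ->
  (fun n => \sum_(i <- r) f i n) @ \oo --> \sum_(i <- r) l i.
Proof. by move=> H0; apply: cvg_big => //; exact: add_continuous. Qed.

Hypothesis alpha01 : 0 <= alpha < 1.
Hypothesis J1_ge0 : 0 <= J1.

Lemma tail_cvg (m : nat) (c : R) : 0 <= c ->
  cvgn (fun N : nat => \sum_(0 <= k < N) (J (m + k).+1 * c)).
Proof.
move=> c0; apply: nondecreasing_is_cvgn.
  move=> x y xy; rewrite (big_cat_nat (n := x) (p := y)) //= lerDl.
  by apply: sumr_ge0 => k _; rewrite mulr_ge0 // Jint_ge0.
exists ((J1 + (1 - alpha)^-1) * c) => _ [N _ <-].
rewrite -mulr_suml ler_wpM2r //.
have a1 : 0 < 1 - alpha by rewrite subr_gt0; case/andP: alpha01.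
case: m => [|m].
  case: N => [|N]; first by rewrite big_nil addr_ge0 // invr_ge0 ltW.
  rewrite big_nat_recl //= lerD2l.
  by have := @sum_Jint_le _ _ alpha01 J1 1 N isT; rewrite powR1 div1r.
apply: le_trans (@sum_Jint_le _ _ alpha01 J1 m.+1 N isT) _.
rewrite -[leLHS]add0r; apply: lerD => //.
rewrite -[leRHS]mul1r ler_pM2r ?invr_gt0 //.
rewrite -[leRHS](powRr0 m.+1%:R); apply: ler_powR; first by rewrite ler1n.
by case/andP: alpha01 => _ /ltW; rewrite subr_le0.
Qed.

Lemma sp_sq b : sp b * sp b = 1.
Proof. by case: b; rewrite /spin; ring. Qed.

Lemma one_sub_sp_ge0 b : 0 <= 1 - sp b * 1.
Proof. by case: b; rewrite /spin mulr1; lra. Qed.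

(** All outer spins are +, so pairs of outer sites contribute 0 and mixed pairs form the partial
    sums of the boundary series. The outer field enters [Hbox] with the factor [- theta], which the
    added sum cancels. *)
Lemma Hfin_lim n (s : {ffun Lam n -> bool}) :
  (fun N => Hbox (n + N) (ext plus_bc s)
     + theta * \sum_(0 <= k < N) (h (n%:Z + 1 + k%:Z) + h (- n%:Z - 1 - k%:Z)))
  @ \oo --> H s.
Proof.
set sg := ext plus_bc s.
pose g i j := J (absz (i - j)%R) * (1 - sp (sg i) * sp (sg j)).
have gs i j : g i j = g j i.
  rewrite /g [sp (sg j) * _]mulrC; congr (J _ * _); lia.
have sgp z : z \notin box n -> sg z = true by move=> hz; rewrite /sg ext_out.
pose u N := 2^-1 * (\sum_(i : Lam n) \sum_(j : Lam n)
            J (absz (site i - site j)%R) * (1 - sp (s i) * sp (s j)))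
  - theta * (\sum_(i : Lam n) h (site i) * sp (s i))
  + \sum_(i : Lam n)
      ((\sum_(0 <= k < N)
          (J (absz (site i - (n%:Z + 1 + k%:Z))%R)
           * (1 - sp (s i) * sp (plus_bc (n%:Z + 1 + k%:Z)))))
     + (\sum_(0 <= k < N)
          (J (absz (site i - (- n%:Z - 1 - k%:Z))%R)
           * (1 - sp (s i) * sp (plus_bc (- n%:Z - 1 - k%:Z)))))).
have -> : (fun N => Hbox (n + N) sg
     + theta * \sum_(0 <= k < N) (h (n%:Z + 1 + k%:Z) + h (- n%:Z - 1 - k%:Z))) = u.
  apply/funext => N; rewrite /Hbox.
  have bs : box (n + N) = zint (- (n + N)%:Z) N ++ box n ++ zint (n%:Z + 1) N.
    have -> : n%:Z + 1 = - n%:Z + (n.*2).+1%:Z by lia.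
    rewrite {1}/box -zint_cat.
    have -> : - n%:Z = - (n + N)%:Z + N%:Z by lia.
    by rewrite -zint_cat /box; congr zint; lia.
  rewrite bs (pair_sum_split _ _ _ gs).
  have oA z : z \in zint (- (n + N)%:Z) N -> sg z = true.
    by move=> hz; apply: sgp; move: hz; rewrite mem_zint mem_box; lia.
  have oC z : z \in zint (n%:Z + 1) N -> sg z = true.
    by move=> hz; apply: sgp; move: hz; rewrite mem_zint mem_box; lia.
  have oAC z : z \in zint (- (n + N)%:Z) N ++ zint (n%:Z + 1) N -> sg z = true.
    by rewrite mem_cat => /orP[/oA|/oC].
  have -> : \sum_(i <- zint (- (n + N)%:Z) N ++ zint (n%:Z + 1) N)
      \sum_(j <- zint (- (n + N)%:Z) N ++ zint (n%:Z + 1) N) g i j = 0.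
    rewrite big_seq big1 // => i /oAC si; rewrite big_seq big1 // => j /oAC sj.
    by rewrite /g si sj sp_sq subrr mulr0.
  rewrite mulr0 addr0 !big_cat /=.
  have -> : \sum_(z <- zint (- (n + N)%:Z) N) h z * sp (sg z) =
            \sum_(z <- zint (- (n + N)%:Z) N) h z.
    by apply: eq_big_seq => z /oA ->; rewrite mulr1.
  have -> : \sum_(z <- zint (n%:Z + 1) N) h z * sp (sg z) =
            \sum_(z <- zint (n%:Z + 1) N) h z.
    by apply: eq_big_seq => z /oC ->; rewrite mulr1.
  rewrite (big_zint_rev _ _ h) (big_zint (n%:Z + 1) _ h).
  have -> : \sum_(0 <= k < N) (h (n%:Z + 1 + k%:Z) + h (- n%:Z - 1 - k%:Z)) =
    \sum_(0 <= k < N) h (n%:Z + 1 + k%:Z) + \sum_(0 <= k < N) h (- n%:Z - 1 - k%:Z).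
    by rewrite big_split.
  rewrite /u.
  rewrite [\sum_(i < _) h _ * _](_ : _ = \sum_(z <- box n) h z * sp (sg z)); last first.
    by rewrite -big_site; apply: eq_bigr => i _; rewrite /sg ext_site.
  rewrite [\sum_(i < _) \sum_(j < _) _](_ : _ = \sum_(i <- box n) \sum_(j <- box n) g i j);
      last first.
    rewrite -big_site; apply: eq_bigr => i _; rewrite -big_site; apply: eq_bigr => j _.
    by rewrite /g /sg !ext_site.
  have -> : \sum_(0 <= k < N) h (- (n + N)%:Z + N%:Z - 1 - k%:Z) =
            \sum_(0 <= k < N) h (- n%:Z - 1 - k%:Z).
    by apply: eq_bigr => k _; congr h; lia.
  have -> : \sum_(i <- box n) (\sum_(j <- zint (- (n + N)%:Z) N) g i j
        + \sum_(j <- zint (n%:Z + 1) N) g i j) =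
    \sum_(i : Lam n) (\sum_(0 <= k < N)
          (J (absz (site i - (n%:Z + 1 + k%:Z))%R)
           * (1 - sp (s i) * sp (plus_bc (n%:Z + 1 + k%:Z))))
     + (\sum_(0 <= k < N)
          (J (absz (site i - (- n%:Z - 1 - k%:Z))%R)
           * (1 - sp (s i) * sp (plus_bc (- n%:Z - 1 - k%:Z)))))); last by ring.
  rewrite -big_site; apply: eq_bigr => i _.
  rewrite addrC big_zint big_zint_rev; congr (_ + _).
    rewrite [LHS]big_nat [RHS]big_nat; apply: eq_bigr => k kN.
    by rewrite /g {1}/sg ext_site oC // mem_zint; lia.
  rewrite [LHS]big_nat [RHS]big_nat; apply: eq_bigr => k kN.
  rewrite /g {1}/sg ext_site oA; last by rewrite mem_zint; lia.
  by congr (J _ * _); lia.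
rewrite /u /Hfin; apply: cvgD; first exact: cvg_cst.
apply: cvg_sum_seq => i; apply: cvgD.
  have -> : (fun N : nat => \sum_(0 <= k < N)
          (J (absz (site i - (n%:Z + 1 + k%:Z))%R)
           * (1 - sp (s i) * sp (plus_bc (n%:Z + 1 + k%:Z))))) =
     (fun N => \sum_(0 <= k < N) (J (absz (n%:Z - site i)%R + k).+1 * (1 - sp (s i) * 1))).
    apply/funext => N; apply: eq_bigr => k _; congr (J _ * _).
    by rewrite /site; have := ltn_ord i; lia.
  by apply: tail_cvg; exact: one_sub_sp_ge0.
have -> : (fun N : nat => \sum_(0 <= k < N)
          (J (absz (site i - (- n%:Z - 1 - k%:Z))%R)
           * (1 - sp (s i) * sp (plus_bc (- n%:Z - 1 - k%:Z))))) =
     (fun N => \sum_(0 <= k < N) (J (absz (n%:Z + site i)%R + k).+1 * (1 - sp (s i) * 1))).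
  apply/funext => N; apply: eq_bigr => k _; congr (J _ * _).
  by rewrite /site; have := ltn_ord i; lia.
by apply: tail_cvg; exact: one_sub_sp_ge0.
Qed.

End Hamiltonian.

Lemma seq_lim_le (R : realType) (u v : nat -> R) (l l' d : R) :
  u @ \oo --> l -> v @ \oo --> l' -> (forall N, u N <= v N + d) -> l <= l' + d.
Proof.
move=> ul vl uv; rewrite -lerBlDl.
have ud : (u N - v N) @[N --> \oo] --> l - l' by apply: cvgB.
by apply: (cvgr_to_le ud); apply: nearW => N; rewrite lerBlDl.
Qed.

(** * Energy change when an interval is flipped *)

Section Flips.
Variable R : realType.
Variables (alpha J1 theta : R) (h : int -> R).

Local Notation J := (Jint alpha J1).
Local Notation sp := (spin R).
Local Notation Lam n := 'I_(n.*2).+1.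
Local Notation H := (Hfin alpha J1 theta h plus_bc).
Local Notation Hbox := (Hbox alpha J1 theta h).

Definition flipc (a : int) (L : nat) (sg : int -> bool) : int -> bool :=
  fun z => (z \in zint a L) (+) sg z.

Definition flipf n (a : int) (L : nat) (s : {ffun Lam n -> bool}) : {ffun Lam n -> bool} :=
  [ffun i => (site i \in zint a L) (+) s i].

Lemma ext_flipf n a L (s : {ffun Lam n -> bool}) : {subset zint a L <= box n} ->
  ext plus_bc (flipf a L s) = flipc a L (ext plus_bc s).
Proof.
move=> sub; apply/funext => z; rewrite /flipc.
have [zb|zb] := boolP (z \in box n).
  by have [i <-] := site_ex zb; rewrite !ext_site ffunE.
rewrite !ext_out //; have : z \notin zint a L by apply: contra zb; exact: sub.
by move=> /negbTE ->.
Qed.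

Lemma flipfK n a L : involutive (@flipf n a L).
Proof. by move=> s; apply/ffunP => i; rewrite !ffunE addKb. Qed.

Lemma sp_negb b : sp (~~ b) = - sp b.
Proof. by case: b; rewrite /spin /= ?opprK. Qed.

(** Only products across the boundary of the interval and its own field term change sign; each
    change of sign gives a factor 2. *)
Lemma Hbox_flip M a L sg (p q : nat) :
  box M = zint (- M%:Z) p ++ zint a L ++ zint (a + L%:Z) q ->
  Hbox M (flipc a L sg) - Hbox M sg =
  2 * (\sum_(i <- zint a L) (\sum_(j <- zint (- M%:Z) p) J (absz (i - j)%R) * (sp (sg i) * sp (sg j))
        + \sum_(j <- zint (a + L%:Z) q) J (absz (i - j)%R) * (sp (sg i) * sp (sg j))))
  + 2 * theta * \sum_(i <- zint a L) h i * sp (sg i).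
Proof.
move=> bs; rewrite /Hbox bs.
set A := zint (- M%:Z) p; set B := zint a L; set C := zint (a + L%:Z) q.
have : uniq (A ++ B ++ C) by rewrite -bs zint_uniq.
rewrite cat_uniq => /and3P[_ /hasPn nA +]; rewrite cat_uniq => /and3P[_ /hasPn nC _].
set sg' := flipc a L sg.
have sB z : z \in B -> sp (sg' z) = - sp (sg z).
  by move=> hz; rewrite /sg' /flipc -/B hz -sp_negb.
have sA z : z \in A -> sg' z = sg z.
  move=> hz; rewrite /sg' /flipc -/B; case E : (z \in B) => //.
  by have := nA z; rewrite mem_cat E hz => /(_ isT).
have sC z : z \in C -> sg' z = sg z.
  move=> hz; rewrite /sg' /flipc -/B; case E : (z \in B) => //.
  by have := nC z hz; rewrite /= E.
have sAC z : z \in A ++ C -> sg' z = sg z by rewrite mem_cat => /orP[/sA|/sC].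
pose g s i j := J (absz (i - j)%R) * (1 - sp (s i) * sp (s j)).
have gs s i j : g s i j = g s j i.
  by rewrite /g [sp (s j) * _]mulrC; congr (J _ * _); lia.
rewrite (pair_sum_split _ _ _ (gs sg)) (pair_sum_split _ _ _ (gs sg')).
have -> : \sum_(i <- B) \sum_(j <- B) g sg' i j = \sum_(i <- B) \sum_(j <- B) g sg i j.
  apply: eq_big_seq => i iB; apply: eq_big_seq => j jB.
  by rewrite /g !sB // mulrNN.
have -> : \sum_(i <- A ++ C) \sum_(j <- A ++ C) g sg' i j =
          \sum_(i <- A ++ C) \sum_(j <- A ++ C) g sg i j.
  apply: eq_big_seq => i iB; apply: eq_big_seq => j jB.
  by rewrite /g !sAC.
rewrite !big_cat /=.
have -> : \sum_(i <- A) h i * sp (sg' i) = \sum_(i <- A) h i * sp (sg i).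
  by apply: eq_big_seq => i iA; rewrite sA.
have -> : \sum_(i <- C) h i * sp (sg' i) = \sum_(i <- C) h i * sp (sg i).
  by apply: eq_big_seq => i iA; rewrite sC.
have -> : \sum_(i <- B) h i * sp (sg' i) = - \sum_(i <- B) h i * sp (sg i).
  by rewrite -sumrN; apply: eq_big_seq => i iA; rewrite sB // mulrN.
have -> : \sum_(i <- B) (\sum_(j <- A) g sg' i j + \sum_(j <- C) g sg' i j) =
   \sum_(i <- B) (\sum_(j <- A) g sg i j + \sum_(j <- C) g sg i j) +
   2 * (\sum_(i <- B) (\sum_(j <- A) J (absz (i - j)%R) * (sp (sg i) * sp (sg j))
        + \sum_(j <- C) J (absz (i - j)%R) * (sp (sg i) * sp (sg j)))).
  rewrite mulr_sumr -big_split /=; apply: eq_big_seq => i iB.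
  rewrite mulrDr !mulr_sumr addrACA -!big_split /=; congr (_ + _).
    by apply: eq_big_seq => j jA; rewrite /g sB // sA //; ring.
  by apply: eq_big_seq => j jA; rewrite /g sB // sC //; ring.
by ring.
Qed.

Lemma sp_prod_le1 b c : sp b * sp c <= 1.
Proof. by case: b; case: c; rewrite /spin; lra. Qed.

Lemma sp_neq b : sp b * sp (~~ b) = -1.
Proof. by case: b; rewrite /spin /=; lra. Qed.

Lemma cross_right a L q (sg : int -> bool) :
  \sum_(i <- zint a L) \sum_(j <- zint (a + L%:Z) q) J (absz (i - j)%R) * (sp (sg i) * sp (sg j)) =
  \sum_(0 <= u < L) \sum_(0 <= w < q)
    J (u + w).+1 * (sp (sg (a + L%:Z - 1 - u%:Z)) * sp (sg (a + L%:Z + w%:Z))).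
Proof.
rewrite big_zint_rev; apply: eq_bigr => u _; rewrite big_zint; apply: eq_bigr => w _.
by congr (J _ * _); lia.
Qed.

Lemma cross_left a L M p (sg : int -> bool) : p%:Z = a + M%:Z ->
  \sum_(i <- zint a L) \sum_(j <- zint (- M%:Z) p) J (absz (i - j)%R) * (sp (sg i) * sp (sg j)) =
  \sum_(0 <= u < L) \sum_(0 <= w < p)
    J (u + w).+1 * (sp (sg (a + u%:Z)) * sp (sg (a - 1 - w%:Z))).
Proof.
move=> pE; rewrite big_zint; apply: eq_bigr => u _; rewrite big_zint_rev.
apply: eq_bigr => w _.
have -> : - M%:Z + p%:Z - 1 - w%:Z = a - 1 - w%:Z by lia.
by congr (J _ * _); lia.
Qed.

Lemma zint_sub_box n M a L : (n <= M)%N -> {subset zint a L <= box n} ->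
  {subset zint a L <= box M}.
Proof. by move=> nM sub z /sub; rewrite !mem_box; lia. Qed.

Hypothesis alpha01 : 0 <= alpha < 1.
Hypothesis J1_ge0 : 0 <= J1.

(** The outer-field correction of [Hfin_lim] is the same for both configurations, so a bound uniform
    in [M] passes to the limit. *)
Lemma Hfin_flip_le n a L (s : {ffun Lam n -> bool}) (d : R) :
  {subset zint a L <= box n} ->
  (forall M, (n <= M)%N ->
     Hbox M (flipc a L (ext plus_bc s)) - Hbox M (ext plus_bc s) <= d) ->
  H (flipf a L s) <= H s + d.
Proof.
move=> sub hd.
have h1 := @Hfin_lim _ _ _ theta h alpha01 J1_ge0 _ (flipf a L s).
have h2 := @Hfin_lim _ _ _ theta h alpha01 J1_ge0 _ s.
apply: (seq_lim_le h1 h2) => N; rewrite ext_flipf //.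
by have := hd (n + N)%N (leq_addr _ _); lra.
Qed.

Lemma cut_sum_le L q (c : nat -> nat -> R) : (forall u w, c u w <= 1) ->
  \sum_(0 <= u < L) \sum_(0 <= w < q) J (u + w).+1 * c u w <= Cut J L q.
Proof.
move=> c1; apply: ler_sum => u _; apply: ler_sum => w _.
by rewrite -[leRHS]mulr1 ler_wpM2l // Jint_ge0.
Qed.

(** Near products are [-1] and far ones at most 1: the sum is at most far minus near, that is, the
    total minus twice near. *)
Lemma cut_sum_near L q (c : nat -> nat -> R) : (L <= q)%N -> (forall u w, c u w <= 1) ->
  (forall u w, (u < L)%N -> (w < L)%N -> c u w = -1) ->
  \sum_(0 <= u < L) \sum_(0 <= w < q) J (u + w).+1 * c u w <= Cut J L q - 2 * Cut J L L.
Proof.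
move=> Lq c1 cn; rewrite /Cut mulr_sumr -sumrB big_nat [leRHS]big_nat.
apply: ler_sum => u /andP[_ uL].
rewrite (big_cat_nat (n := L)) //= [in leRHS](big_cat_nat (n := L)) //=.
have -> : \sum_(0 <= w < L) J (u + w).+1 * c u w = - \sum_(0 <= w < L) J (u + w).+1.
  rewrite -sumrN big_nat [RHS]big_nat; apply: eq_bigr => w /andP[_ wL].
  by rewrite cn // mulrN1.
have : \sum_(L <= w < q) J (u + w).+1 * c u w <= \sum_(L <= w < q) J (u + w).+1.
  by apply: ler_sum => w _; rewrite -[leRHS]mulr1 ler_wpM2l // Jint_ge0.
by lra.
Qed.

(** The 4 is the factor 2 of [Hbox_flip] times the two sides of the interval. *)
Lemma flip_const_le n a L (s : {ffun Lam n -> bool}) (b : bool) (c : R) :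
  {subset zint a L <= box n} -> (0 < L)%N ->
  (forall z, z \in zint a L -> ext plus_bc s z = b) ->
  (forall q, Cut J L q <= c) ->
  H (flipf a L s) <= H s + (4 * c + 2 * theta * (sp b * \sum_(i <- zint a L) h i)).
Proof.
move=> sub L0 sb hc; apply: Hfin_flip_le => // M nM.
have [p [q [bs pE qE]]] := box_split (zint_sub_box nM sub) L0.
rewrite (Hbox_flip _ bs) big_split /= cross_right (cross_left _ _ pE).
have := le_trans (cut_sum_le L q (fun u w => sp_prod_le1 (ext plus_bc s (a + L%:Z - 1 - u%:Z)) (ext plus_bc s (a + L%:Z + w%:Z)))) (hc q).
have := le_trans (cut_sum_le L p (fun u w => sp_prod_le1 (ext plus_bc s (a + u%:Z)) (ext plus_bc s (a - 1 - w%:Z)))) (hc p).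
have -> : \sum_(i <- zint a L) h i * sp (ext plus_bc s i) = sp b * \sum_(i <- zint a L) h i.
  by rewrite mulr_sumr; apply: eq_big_seq => z /sb ->; rewrite mulrC.
lra.
Qed.

Lemma flip_isolated_le n a L (s : {ffun Lam n -> bool}) (b : bool) (c : R) :
  (forall z, a - L%:Z <= z < a + L%:Z + L%:Z -> z \in box n) -> (0 < L)%N ->
  (forall z, a <= z < a + L%:Z -> ext plus_bc s z = b) ->
  (forall z, a + L%:Z <= z < a + L%:Z + L%:Z -> ext plus_bc s z = ~~ b) ->
  (forall z, a - L%:Z <= z < a -> ext plus_bc s z = ~~ b) ->
  (forall q, (L <= q)%N -> Cut J L q - 2 * Cut J L L <= - c) ->
  H (flipf a L s) <= H s + (- 4 * c + 2 * theta * (sp b * \sum_(i <- zint a L) h i)).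
Proof.
move=> sub L0 sb sr sl hc.
have sub' : {subset zint a L <= box n}.
  by move=> z; rewrite mem_zint => hz; apply: sub; lia.
apply: Hfin_flip_le => // M nM.
have [p [q [bs pE qE]]] := box_split (zint_sub_box nM sub') L0.
have Lp : (L <= p)%N.
  by have := sub (a - L%:Z); rewrite mem_box; lia.
have Lq : (L <= q)%N.
  by have := sub (a + L%:Z + L%:Z - 1); rewrite mem_box; lia.
rewrite (Hbox_flip _ bs) big_split /= cross_right (cross_left _ _ pE).
have cR u w : (u < L)%N -> (w < L)%N ->
    sp (ext plus_bc s (a + L%:Z - 1 - u%:Z)) * sp (ext plus_bc s (a + L%:Z + w%:Z)) = -1.
  by move=> uL wL; rewrite sb ?sr ?sp_neq //; lia.
have cL u w : (u < L)%N -> (w < L)%N ->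
    sp (ext plus_bc s (a + u%:Z)) * sp (ext plus_bc s (a - 1 - w%:Z)) = -1.
  by move=> uL wL; rewrite sb ?sl ?sp_neq //; lia.
have hR := le_trans (cut_sum_near Lq (fun u w => sp_prod_le1 _ _) cR) (hc q Lq).
have hL := le_trans (cut_sum_near Lp (fun u w => sp_prod_le1 _ _) cL) (hc p Lp).
have -> : \sum_(i <- zint a L) h i * sp (ext plus_bc s i) = sp b * \sum_(i <- zint a L) h i.
  rewrite mulr_sumr; apply: eq_big_seq => z; rewrite mem_zint => /sb ->.
  by rewrite mulrC.
lra.
Qed.
End Flips.

(** * Gibbs measures *)

Section GibbsMeasure.
Variable R : realType.
Variables (alpha J1 theta beta : R) (h : int -> R).

Local Notation J := (Jint alpha J1).
Local Notation sp := (spin R).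
Local Notation Lam n := 'I_(n.*2).+1.
Local Notation H := (Hfin alpha J1 theta h plus_bc).
Local Notation gibbs n E := (gibbs_prob alpha J1 theta beta h n plus_bc E).

Definition weight n (s : {ffun Lam n -> bool}) : R := expR (- beta * H s).
Definition Zpart n : R := \sum_(s : {ffun Lam n -> bool}) weight s.

Lemma weight_gt0 n (s : {ffun Lam n -> bool}) : 0 < weight s.
Proof. exact: expR_gt0. Qed.

Lemma Zpart_gt0 n : 0 < Zpart n.
Proof.
rewrite /Zpart (bigD1 [ffun=> true]) //= ltr_pwDl ?weight_gt0 //.
by apply: sumr_ge0 => s _; rewrite ltW ?weight_gt0.
Qed.

Lemma gibbsE n E : gibbs n E =
  (\sum_(s : {ffun Lam n -> bool} | `[< E (ext plus_bc s) >]) weight s) / Zpart n.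
Proof. by []. Qed.

Lemma gibbs_ge0 n E : 0 <= gibbs n E.
Proof.
rewrite gibbsE divr_ge0 ?(ltW (Zpart_gt0 n)) //.
by apply: sumr_ge0 => s _; rewrite ltW ?weight_gt0.
Qed.

Lemma gibbs_union n (E : (int -> bool) -> Prop) (I : Type) (r : seq I)
    (B : I -> {ffun Lam n -> bool} -> bool) (e : R) :
  (forall s, ~ E (ext plus_bc s) -> has (fun i => B i s) r) ->
  (forall i, (\sum_(s | B i s) weight s) / Zpart n <= e) ->
  1 - (size r)%:R * e <= gibbs n E.
Proof.
move=> cov Be; have Z0 := Zpart_gt0 n.
rewrite lerBlDr gibbsE.
have h1 : \sum_(s : {ffun Lam n -> bool} | ~~ `[< E (ext plus_bc s) >]) weight s <=
    \sum_(i <- r) \sum_(s | B i s) weight s.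
  rewrite [leRHS](eq_bigr (fun i => \sum_s if B i s then weight s else 0)); last first.
    by move=> i _; rewrite big_mkcond.
  rewrite exchange_big /= big_mkcond; apply: ler_sum => s _.
  have pos (r' : seq I) : 0 <= \sum_(i <- r') (if B i s then weight s else 0).
    by apply: sumr_ge0 => i _; case: ifP => // _; rewrite ltW ?weight_gt0.
  case: ifPn => [/asboolPn /cov|_]; last exact: pos.
  elim: r {cov} => //= i r IH /orP[Bi|/IH {}IH]; rewrite big_cons.
    by rewrite Bi lerDl pos.
  apply: le_trans IH _; rewrite lerDr; case: ifP => // _.
  by rewrite ltW ?weight_gt0.
have h2 : (\sum_(i <- r) \sum_(s | B i s) weight s) / Zpart n <= (size r)%:R * e.
  rewrite mulr_suml; elim: r {cov h1} => [|i r IH]; first by rewrite big_nil mul0r.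
  by rewrite big_cons /= -natr1 mulrDl mul1r addrC lerD.
have h3 : Zpart n = \sum_(s : {ffun Lam n -> bool} | `[< E (ext plus_bc s) >]) weight s +
   \sum_(s : {ffun Lam n -> bool} | ~~ `[< E (ext plus_bc s) >]) weight s.
  by rewrite /Zpart (bigID (fun s => `[< E (ext plus_bc s) >])).
rewrite -(ler_pM2r Z0) mul1r mulrDl divfK ?gt_eqF // {1}h3 lerD2l.
by apply: (le_trans h1); move: h2; rewrite ler_pdivrMr.
Qed.

(** Peierls argument: on this event the flip multiplies the weight by at least [e^(beta d)], and,
    being a bijection, it produces weights of total at most [Zpart n]. *)
Lemma flip_prob n a L (d : R) : 0 <= beta ->
  (\sum_(s : {ffun Lam n -> bool} | H (flipf a L s) <= H s - d) weight s) / Zpart n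
    <= expR (- beta * d).
Proof.
move=> b0; rewrite ler_pdivrMr ?Zpart_gt0 //.
apply: (@le_trans _ _ (\sum_(s : {ffun Lam n -> bool} | H (flipf a L s) <= H s - d)
   expR (- beta * d) * weight (flipf a L s))).
  apply: ler_sum => s hs; rewrite /weight -expRD ler_expR.
  have := ler_wpM2l b0 hs; lra.
rewrite -mulr_sumr ler_pM2l ?expR_gt0 //.
apply: (@le_trans _ _ (\sum_(s : {ffun Lam n -> bool}) weight (flipf a L s))).
  rewrite [leRHS](bigID (fun s => H (flipf a L s) <= H s - d)) /= lerDl.
  by apply: sumr_ge0 => s _; rewrite ltW ?weight_gt0.
rewrite /Zpart [leRHS](reindex_inj (h := @flipf n a L)) //.
exact: inv_inj (@flipfK n a L).
Qed.

Hypothesis alpha01 : 0 <= alpha < 1.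
Hypothesis J1_ge0 : 0 <= J1.
Hypothesis beta_ge0 : 0 <= beta.

(** Field and boundary terms are sums of functions of one spin and are preserved exactly ([lin]);
    the ferromagnetic pair terms are compared on all values of the four spins. *)
Lemma Hfin_submodular n (s t : {ffun Lam n -> bool}) :
  H (joinf s t) + H (meetf s t) <= H s + H t.
Proof.
have lin (f : Lam n -> bool -> R) :
   \sum_i f i (joinf s t i) + \sum_i f i (meetf s t i) = \sum_i f i (s i) + \sum_i f i (t i).
  rewrite -!big_split /=; apply: eq_bigr => i _; rewrite !ffunE.
  by case: (s i); case: (t i); rewrite //= addrC.
pose B (i : Lam n) (b : bool) :=
  limn (fun N : nat => \sum_(0 <= k < N)
          (J (absz (site i - (n%:Z + 1 + k%:Z))%R)
           * (1 - sp b * sp (plus_bc (n%:Z + 1 + k%:Z)))))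
     + limn (fun N : nat => \sum_(0 <= k < N)
          (J (absz (site i - (- n%:Z - 1 - k%:Z))%R)
           * (1 - sp b * sp (plus_bc (- n%:Z - 1 - k%:Z))))).
have hB := lin B.
have hh := lin (fun i b => h (site i) * sp b).
pose Q (s : {ffun Lam n -> bool}) := \sum_(i : Lam n) \sum_(j : Lam n)
            J (absz (site i - site j)%R) * (1 - sp (s i) * sp (s j)).
have hQ : Q (joinf s t) + Q (meetf s t) <= Q s + Q t.
  rewrite -!big_split /=; apply: ler_sum => i _; rewrite -!big_split /=.
  apply: ler_sum => j _; rewrite -!mulrDr ler_wpM2l ?Jint_ge0 // !ffunE.
  by case: (s i); case: (s j); case: (t i); case: (t j); rewrite /spin /=; lra.
have HE u : H u = 2^-1 * Q u - theta * (\sum_i h (site i) * sp (u i)) + \sum_i B i (u i).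
  by [].
have := congr1 (fun x => theta * x) hh; rewrite !mulrDr => hh'.
rewrite !HE; lra.
Qed.

Definition restr m (sg : int -> bool) : {ffun Lam m -> bool} := [ffun i => sg (site i)].

Lemma ext_restr n (s : {ffun Lam n -> bool}) :
  ext plus_bc (restr n.+1 (ext plus_bc s)) = ext plus_bc s.
Proof.
apply/funext => z; have [zb|zb] := boolP (z \in box n.+1).
  by have [i <-] := site_ex zb; rewrite ext_site ffunE.
rewrite !ext_out //; apply: contra zb; rewrite !mem_box; lia.
Qed.

(** The two new sites already interact as + boundary sites in [H s]; only their field is new, and it
    does not depend on [s]. *)
Lemma Hfin_restr n (s : {ffun Lam n -> bool}) :
  H (restr n.+1 (ext plus_bc s)) = H s - theta * (h (n%:Z + 1) + h (- n%:Z - 1)).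
Proof.
have h1 := @Hfin_lim _ _ _ theta h alpha01 J1_ge0 _ (restr n.+1 (ext plus_bc s)).
have := @Hfin_lim _ _ _ theta h alpha01 J1_ge0 _ s.
rewrite -cvg_shiftS /= => h2.
set d := theta * _.
have e N : Hbox alpha J1 theta h (n + N.+1) (ext plus_bc s) +
     theta * \sum_(0 <= k < N.+1) (h (n%:Z + 1 + k%:Z) + h (- n%:Z - 1 - k%:Z)) =
   Hbox alpha J1 theta h (n.+1 + N) (ext plus_bc (restr n.+1 (ext plus_bc s))) +
     theta * \sum_(0 <= k < N) (h (n.+1%:Z + 1 + k%:Z) + h (- n.+1%:Z - 1 - k%:Z)) + d.
  rewrite ext_restr addnS addSn big_nat_recl //= /d.
  rewrite [\sum_(0 <= i < N) (h (n%:Z + 1 + _) + _)](_ : _ =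
    \sum_(0 <= k < N) (h (n.+1%:Z + 1 + k%:Z) + h (- n.+1%:Z - 1 - k%:Z))); last first.
    by apply: eq_bigr => k _; congr (h _ + h _); lia.
  by rewrite addr0 subr0; ring.
apply/eqP; rewrite eq_le; apply/andP; split.
  by apply: (seq_lim_le h1 h2) => N; rewrite e; lra.
rewrite lerBlDr; by apply: (seq_lim_le h2 h1) => N; rewrite e.
Qed.

Definition plus_on (A : seq int) (sg : int -> bool) : Prop := all sg A.

(** The measure on the smaller box is the one on the larger box conditioned on the event [E] that
    both new spins are +. By FKG this conditioning can only raise the probability of the increasing
    event [F]. *)
Lemma gibbs_plus_mono n A : gibbs n.+1 (plus_on A) <= gibbs n (plus_on A).
Proof.
pose up (s : {ffun Lam n -> bool}) := restr n.+1 (ext plus_bc s).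
pose dn (t : {ffun Lam n.+1 -> bool}) := restr n (ext plus_bc t).
pose E (t : {ffun Lam n.+1 -> bool}) :=
  ext plus_bc t (n%:Z + 1) && ext plus_bc t (- n%:Z - 1).
pose F (t : {ffun Lam n.+1 -> bool}) := all (ext plus_bc t) A.
pose c := expR (- beta * - (theta * (h (n%:Z + 1) + h (- n%:Z - 1)))).
have c0 : 0 < c by exact: expR_gt0.
have wup s : weight (up s) = c * weight s.
  by rewrite /weight Hfin_restr -expRD; congr expR; ring.
have upE s : E (up s) by rewrite /E /up ext_restr !ext_out // mem_box; lia.
have updn t : E t -> up (dn t) = t.
  move=> /andP[e1 e2]; apply/ffunP => i; rewrite ffunE.
  have [ib|ib] := boolP (site i \in box n).
    by have [j ej] := site_ex ib; rewrite -ej ext_site ffunE ej ext_site.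
  rewrite ext_out // -(ext_site plus_bc t i).
  have [->|->] : site i = n%:Z + 1 \/ site i = - n%:Z - 1.
  - by move: ib; rewrite mem_box /site; have := ltn_ord i; lia.
  - by rewrite e1.
  - by rewrite e2.
have dnup s : dn (up s) = s.
  by apply/ffunP => i; rewrite ffunE /up ext_restr ext_site.
(* [up] is a bijection onto [E] that multiplies every weight by [c], so [c] cancels in the
   ratios. *)
have sumE (P : pred {ffun Lam n.+1 -> bool}) :
    \sum_(t | P t && E t) weight t = c * \sum_(s | P (up s)) weight s.
  rewrite (reindex_onto up dn); last by move=> t /andP[_]; exact: updn.
  rewrite mulr_sumr; apply: eq_big => s; last by rewrite wup.
  by rewrite upE dnup eqxx !andbT.
have WW (s t : {ffun Lam n.+1 -> bool}) :
    weight s * weight t <= weight (joinf s t) * weight (meetf s t).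
  rewrite /weight -!expRD ler_expR -!mulrDr !mulNr lerN2.
  by rewrite ler_wpM2l // Hfin_submodular.
have extj (s t : {ffun Lam n.+1 -> bool}) z :
    ext plus_bc (joinf s t) z = ext plus_bc s z || ext plus_bc t z.
  have [zb|zb] := boolP (z \in box n.+1); last by rewrite !ext_out.
  by have [i <-] := site_ex zb; rewrite !ext_site ffunE.
have := @FKG R _ (@weight n.+1) F E (fun s => ltW (weight_gt0 s)) WW.
have Fm s t : F s -> F (joinf s t).
  by move=> /allP Fs; apply/allP => z zA; rewrite extj Fs.
have Em s t : E t -> E (joinf s t).
  by rewrite /E !extj => /andP[-> ->]; rewrite !orbT.
move=> /(_ Fm Em); rewrite sumE.
have -> : \sum_(s | E s) weight s = c * Zpart n by rewrite -(sumE predT).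
rewrite -/(Zpart n.+1) !gibbsE.
have eF : \sum_(s : {ffun Lam n.+1 -> bool} | `[< plus_on A (ext plus_bc s) >]) weight s =
   \sum_(s | F s) weight s.
  by apply: eq_bigl => s; apply/asboolP/idP.
have eF' : \sum_(s : {ffun Lam n -> bool} | `[< plus_on A (ext plus_bc s) >]) weight s =
   \sum_(s | F (up s)) weight s.
  apply: eq_bigl => s; rewrite /F /up ext_restr; exact/asboolP/idP.
rewrite eF eF' mulrCA -mulrA ler_pM2l // => hF.
rewrite ler_pdivrMr ?Zpart_gt0 // mulrAC ler_pdivlMr ?Zpart_gt0 //.
Qed.

Definition cyl (A B : seq int) (sg : int -> bool) : Prop :=
  all sg A && all (fun z => ~~ sg z) B.

(** Each prescribed minus is removed by [P(A+, x-, B-) = P(A+, B-) - P(A+, x+, B-)], down to the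
    monotone probabilities of [plus_on]. *)
Lemma cyl_cvg A B : cvgn (fun n => gibbs n (cyl A B)).
Proof.
elim: B A => [|x B IH] A.
  have -> : (fun n => gibbs n (cyl A [::])) = (fun n => gibbs n (plus_on A)).
    by apply/funext => n; congr gibbs_prob; apply/funext => sg; rewrite /cyl /= andbT.
  apply: nonincreasing_is_cvgn; last first.
    by exists 0 => _ [n _ <-]; exact: gibbs_ge0.
  by apply/nonincreasing_seqP => n; exact: gibbs_plus_mono.
have -> : (fun n => gibbs n (cyl A (x :: B))) =
   (fun n => gibbs n (cyl A B) - gibbs n (cyl (x :: A) B)).
  apply/funext => n; rewrite !gibbsE -mulrBl; congr (_ / _).
  apply/eqP; rewrite eq_sym subr_eq; apply/eqP.
  rewrite (bigID (fun s => ext plus_bc s x)) /= addrC; congr (_ + _).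
    apply: eq_bigl => s; apply/andP/asboolP => [[/asboolP]|]; rewrite /cyl /=.
      by move=> /andP[-> ->] ->.
    by move=> /and3P[-> -> ->]; split => //; apply/asboolP.
  apply: eq_bigl => s; apply/andP/asboolP => [[/asboolP]|]; rewrite /cyl /=.
    by move=> /andP[-> ->] ->.
  by move=> /andP[/andP[-> ->] ->]; split => //; apply/asboolP.
by apply: is_cvgB.
Qed.

(** [E] is a finite disjoint union of cylinders, one for each pattern on the box that satisfies
    it. *)
Lemma local_cvg (m : nat) (E : (int -> bool) -> Prop) :
  (forall sg sg' : int -> bool, (forall z : int, z \in box m -> sg z = sg' z) -> E sg -> E sg') ->
  cvgn (fun n => gibbs n E).
Proof.
move=> loc.
pose pos (p : {ffun Lam m -> bool}) := [seq z <- box m | ext plus_bc p z].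
pose neg (p : {ffun Lam m -> bool}) := [seq z <- box m | ~~ ext plus_bc p z].
have cylP p sg : cyl (pos p) (neg p) sg <-> restr m sg = p.
  split.
    move=> /andP[/allP hp /allP hn]; apply/ffunP => i; rewrite ffunE.
    have ib : site i \in box m by rewrite mem_box /site; have := ltn_ord i; lia.
    have := hp (site i); have := hn (site i); rewrite !mem_filter ib !andbT ext_site.
    by case: (p i) => [_ ->|/(_ isT)/negbTE ->].
  move=> <-; apply/andP; split; apply/allP => z; rewrite mem_filter => /andP[+ zb];
    by have [i <-] := site_ex zb; rewrite ext_site ffunE.
have -> : (fun n => gibbs n E) =
   (fun n => \sum_(p <- enum {ffun Lam m -> bool} | `[< E (ext plus_bc p) >])
       gibbs n (cyl (pos p) (neg p))).
  apply/funext => n.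
  rewrite -mulr_suml !gibbsE big_enum_cond /=; congr (_ / _).
  rewrite (partition_big (fun s => restr m (ext plus_bc s)) (fun p => `[< E (ext plus_bc p) >])).
    apply: eq_bigr => p /asboolP Ep; apply: eq_bigl => s.
    apply/andP/asboolP => [[_ /eqP /cylP]//|/cylP rp]; split; last exact/eqP.
    apply/asboolP; apply: loc Ep => z zb.
    by rewrite -rp; have [i <-] := site_ex zb; rewrite ext_site ffunE.
  move=> s /asboolP Es; apply/asboolP; apply: loc Es => z zb.
  by have [i <-] := site_ex zb; rewrite ext_site ffunE.
pose l p := limn (fun n => gibbs n (cyl (pos p) (neg p))).
apply/cvg_ex; exists (\sum_(p <- enum {ffun Lam m -> bool} | `[< E (ext plus_bc p) >]) l p).
apply: cvg_big; first exact: add_continuous.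
by move=> p _; exact: cyl_cvg.
Qed.

End GibbsMeasure.

(** * Runs *)

Section Runs.

Definition isolated (sg : int -> bool) (a : int) (L : nat) : Prop :=
  exists b : bool, [/\ forall z, a <= z < a + L%:Z -> sg z = b,
    forall z, a + L%:Z <= z < a + L%:Z + L%:Z -> sg z = ~~ b &
    forall z, a - L%:Z <= z < a -> sg z = ~~ b].

(* If a run has a strictly shorter neighbour, move to that neighbour and repeat: the
   lengths decrease, so one stops at a run not longer than its two neighbours. *)
Lemma short_run_isolated (sg : int -> bool) (L : nat) (a b : int) :
  finite_run sg a b -> b - a + 1 <= L%:Z ->
  exists a' L', [/\ (0 < L' <= L)%N, `|a' - a| <= (L * L)%:Z & isolated sg a' L'].
Proof.
elim: L a b => [|L IH] a b [ab con la rb] len; first by lia.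
pose l := absz (b - a + 1)%R.
have lE : l%:Z = b - a + 1 by rewrite /l; lia.
have sb : sg b = sg a by apply: con; lia.
have [|noR] := boolP [exists k : 'I_l, sg (b + 1 + k%:Z) == sg a].
  move=> /existsP[k0 k0E].
  have ex : exists k : nat, (k < l)%N && (sg (b + 1 + k%:Z) == sg a).
    by exists k0; rewrite ltn_ord.
  (* The least [k] ends the right neighbour, which thus has length [k < l]. Each move goes at most
     [l] sites and lowers the length bound, whence the total distance [L * L]. *)
  case: (ex_minnP ex) => k /andP[kl /eqP kE] kmin.
  have k1 : (0 < k)%N.
    case: k kE {kl kmin} => // e; move: rb; rewrite sb.
    by rewrite addr0 in e; rewrite e eqxx.
  have inner z : b + 1 <= z <= b + k%:Z -> sg z = ~~ sg a.
    move=> hz; have := kmin (absz (z - (b + 1))%R).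
    have -> : b + 1 + (absz (z - (b + 1))%R)%:Z = z by lia.
    have : (absz (z - (b + 1))%R < k)%N by lia.
    move=> zk; rewrite (ltn_trans zk kl) /= leqNgt zk.
    by case: (sg z); case: (sg a) => // /(_ isT).
  have [||a' [L' [L'0 dist iso]]] := IH (b + 1) (b + k%:Z).
  - split; first by lia.
    + by move=> z hz; rewrite (inner z hz) (inner (b + 1)) //; lia.
    + rewrite (_ : b + 1 - 1 = b); last by lia.
      by rewrite sb (inner (b + 1)); [case: (sg a) | lia].
    + rewrite (_ : b + k%:Z + 1 = b + 1 + k%:Z); last by lia.
      by rewrite kE (inner (b + k%:Z)); [case: (sg a) | lia].
  - by lia.
  - exists a', L'; split => //; first by lia.
    by rewrite mulSn mulnS; lia.
have [|noL] := boolP [exists k : 'I_l, sg (a - 1 - k%:Z) == sg a].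
  move=> /existsP[k0 k0E].
  have ex : exists k : nat, (k < l)%N && (sg (a - 1 - k%:Z) == sg a).
    by exists k0; rewrite ltn_ord.
  case: (ex_minnP ex) => k /andP[kl /eqP kE] kmin.
  have k1 : (0 < k)%N.
    case: k kE {kl kmin} => // e; move: la.
    by rewrite subr0 in e; rewrite e eqxx.
  have inner z : a - k%:Z <= z <= a - 1 -> sg z = ~~ sg a.
    move=> hz; have := kmin (absz (a - 1 - z)%R).
    have -> : a - 1 - (absz (a - 1 - z)%R)%:Z = z by lia.
    have : (absz (a - 1 - z)%R < k)%N by lia.
    move=> zk; rewrite (ltn_trans zk kl) /= leqNgt zk.
    by case: (sg z); case: (sg a) => // /(_ isT).
  have [||a' [L' [L'0 dist iso]]] := IH (a - k%:Z) (a - 1).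
  - split; first by lia.
    + by move=> z hz; rewrite (inner z hz) (inner (a - k%:Z)) //; lia.
    + rewrite (_ : a - k%:Z - 1 = a - 1 - k%:Z); last by lia.
      by rewrite kE (inner (a - k%:Z)); [case: (sg a) | lia].
    + rewrite (_ : a - 1 + 1 = a); last by lia.
      by rewrite (inner (a - 1)); [case: (sg a) | lia].
  - by lia.
  - exists a', L'; split => //; first by lia.
    by rewrite mulSn mulnS; lia.
exists a, l; split; [by lia|by lia|].
move: noR noL; rewrite !negb_exists => /forallP noR /forallP noL.
exists (sg a); split => z hz; first by apply: con; lia.
- have kl : (absz (z - (b + 1))%R < l)%N by lia.
  have := noR (Ordinal kl) => /=.
  have -> : b + 1 + (absz (z - (b + 1))%R)%:Z = z by lia.
  by case: (sg z); case: (sg a).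
- have kl : (absz (a - 1 - z)%R < l)%N by lia.
  have := noL (Ordinal kl) => /=.
  have -> : a - 1 - (absz (a - 1 - z)%R)%:Z = z by lia.
  by case: (sg z); case: (sg a).
Qed.

(** The radius is [v + 1] because a run is recognised by the spins just beyond its ends. *)
Lemma runs_ok_local (R : realType) (D lo hi sc : R) (v : nat) :
  (forall z, centered_interval D z -> `|z| <= v%:Z) ->
  forall sg sg' : int -> bool, (forall z : int, z \in box v.+1 -> sg z = sg' z) ->
  runs_ok D lo hi sc sg -> runs_ok D lo hi sc sg'.
Proof.
move=> hv sg sg' e ok a b [ab con la rb] inV; apply: ok => //.
have [ha hb] : `|a| <= v%:Z /\ `|b| <= v%:Z.
  by split; apply: hv; apply: inV; lia.
have e' z : a - 1 <= z <= b + 1 -> sg z = sg' z.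
  by move=> hz; apply: e; rewrite mem_box; lia.
split => //; [|by rewrite !e' //; lia|by rewrite !e' //; lia].
by move=> z hz; rewrite !e' ?con //; lia.
Qed.

End Runs.

(** * Union bound over the flips that remove bad runs *)

Section GibbsRuns.
Variable R : realType.
Variables (alpha J1 theta beta : R) (h : int -> R).
Local Notation J := (Jint alpha J1).
Local Notation sp := (spin R).
Local Notation gibbs n E := (gibbs_prob alpha J1 theta beta h n plus_bc E).
Local Notation H := (Hfin alpha J1 theta h plus_bc).

Definition field_small (G : nat -> R) (lmin r : nat) : Prop :=
  forall (a : int) L, `|a| <= r%:Z -> (0 < L <= lmin)%N ->
    theta * `|\sum_(i <- zint a L) h i| <= G L.

(** Whatever the spin [b] of a run starting at [a], one of the first [K] blocks of length [ell] has
    a field strongly opposed to it. *)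
Definition field_large (c : R) (K ell r : nat) : Prop :=
  forall (a : int) (b : bool), `|a| <= r%:Z -> exists2 k, (k < K)%N &
    theta * (sp b * \sum_(i <- zint (a + (k * ell)%:Z) ell) h i) <= - c.

Lemma gibbs_runs (D lo hi sc c : R) (lmin ell K v : nat) (G : nat -> R) n :
  0 <= alpha < 1 -> 0 <= J1 -> 0 <= beta -> 0 <= theta ->
  (forall L : nat, sc * L%:R < lo -> (L <= lmin)%N) ->
  (forall L : nat, hi < sc * L%:R -> (K * ell <= L)%N) ->
  (forall z, centered_interval D z -> `|z| <= v%:Z) ->
  (0 < ell)%N ->
  (forall L q, (0 < L)%N -> (L <= q)%N -> Cut J L q - 2 * Cut J L L <= - G L) ->
  (forall L, (0 < L)%N -> 1 <= G L) ->
  (forall q, Cut J ell q <= c) ->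
  field_small G lmin (v + lmin * lmin) ->
  field_large (2 * c + 1) K ell v ->
  let r := (v + lmin * lmin + 2 * lmin + K * ell)%N in
  (r <= n)%N ->
  1 - ((2 * r + 1) * (lmin + ell + 1))%:R * expR (- beta * 2)
    <= gibbs n (runs_ok D lo hi sc).
Proof.
move=> a01 J10 b0 t0 hlo hhi hv ell0 near G1 cost fs fl r rn.
pose idx := [seq (a, L) | a <- box r, L <- iota 0 (lmin + ell + 1)].
have -> : ((2 * r + 1) * (lmin + ell + 1) = size idx)%N.
  by rewrite size_allpairs size_zint size_iota; congr (_ * _)%N; lia.
apply: (@gibbs_union _ _ _ _ _ _ n _ _ idx
  (fun i s => H (flipf i.1 i.2 s) <= H s - 2)); last first.
  by move=> i; exact: flip_prob.
move=> s bad; set sg := ext plus_bc s in bad.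
suff [a [L [ar Ll le]]] : exists a L, [/\ a \in box r, (L < lmin + ell + 1)%N &
    H (flipf a L s) <= H s - 2].
  by apply/hasP; exists (a, L) => //; apply: allpairs_f; rewrite ?mem_iota.
move/existsNP: bad => [a /existsNP[b /not_implyP[run /not_implyP[inV bad]]]].
have [ab con _ _] := run.
have [ha hb] : `|a| <= v%:Z /\ `|b| <= v%:Z.
  by split; apply: hv; apply: inV; lia.
pose l := absz (b - a + 1)%R.
have lE : b - a + 1 = l%:Z by rewrite /l; lia.
move: bad; rewrite lE => /negP; rewrite negb_and -!ltNge => /orP[short|long].
  have ll : (l <= lmin)%N by apply: hlo.
  have [|a' [L' [L'0 dist [bb [c1 c2 c3]]]]] := @short_run_isolated sg lmin a b run.
    by lia.
  have a'r : `|a'| <= (v + lmin * lmin)%:Z by lia.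
  exists a', L'; split; [by rewrite mem_box /r; lia|by lia|].
  have L0 : (0 < L')%N by lia.
  have sub z : a' - L'%:Z <= z < a' + L'%:Z + L'%:Z -> z \in box n.
    by rewrite mem_box; move: rn; rewrite /r; lia.
  apply: le_trans (flip_isolated_le theta h a01 J10 sub L0 c1 c2 c3 (fun q hq => near L' q L0 hq)) _.
  rewrite lerD2l.
  (* The interaction gains [4 G L'], the field takes back at most [2 G L'], and [G L' >= 1] leaves
     at least 2. *)
  have := fs a' L' a'r L'0; have := G1 L' L0.
  have : sp bb * \sum_(i <- zint a' L') h i <= `|\sum_(i <- zint a' L') h i|.
    case: bb {c1 c2 c3}; rewrite /spin ?mul1r ?mulN1r ?ler_norm //.
    by rewrite -normrN ler_norm.
  by move/(ler_wpM2l t0); nra.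
have ll : (K * ell <= l)%N by apply: hhi.
have [k kK hk] := fl a (sg a) ha.
have kl : (k * ell + ell <= K * ell)%N.
  by rewrite addnC -mulSn leq_mul2r kK orbT.
exists (a + (k * ell)%:Z), ell; split; [by rewrite mem_box /r; lia|by lia|].
have sub : {subset zint (a + (k * ell)%:Z) ell <= box n}.
  by move=> z; rewrite mem_zint mem_box; move: rn; rewrite /r; lia.
have cs z : z \in zint (a + (k * ell)%:Z) ell -> ext plus_bc s z = sg a.
  by rewrite mem_zint => hz; apply: con; lia.
(* The level [2 c + 1] is fixed by [4 c - 2 (2 c + 1) = -2]. *)
apply: le_trans (flip_const_le theta h a01 J10 sub ell0 cs cost) _.
by rewrite lerD2l; lra.
Qed.

End GibbsRuns.

(** * Random walks and independent signs *)

Section Walk.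
Variable R : realType.
Implicit Types (f g : R -> R) (x y : R).

(** Expectation of [f (x + S_n)] for the simple random walk [S_n]; with a free starting point,
    moment formulas are inductions on [n]. *)
Fixpoint walkE (n : nat) f x : R :=
  if n is n'.+1 then (walkE n' f (x + 1) + walkE n' f (x - 1)) / 2 else f x.

Lemma walkE_le n f g x : (forall y, f y <= g y) -> walkE n f x <= walkE n g x.
Proof.
by move=> fg; elim: n x => [|n IH] x //=; rewrite ler_pM2r ?invr_gt0 // lerD.
Qed.

Lemma walkE_lin n (a b : R) f g x :
  walkE n (fun y => a * f y + b * g y) x = a * walkE n f x + b * walkE n g x.
Proof. by elim: n x => [|n IH] x //=; rewrite !IH; field. Qed.

Lemma walkE_cst n (c : R) x : walkE n (fun=> c) x = c.
Proof. by elim: n x => [|n IH] x //=; rewrite !IH; field. Qed.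

Lemma walkE_opp n f x : walkE n (fun y => f (- y)) x = walkE n f (- x).
Proof.
elim: n x => [|n IH] x //=; rewrite !IH addrC.
by congr ((walkE n f _ + walkE n f _) / 2); ring.
Qed.

Lemma walkE_sqr n x : walkE n (fun y => y ^+ 2) x = x ^+ 2 + n%:R.
Proof.
elim: n x => [|n IH] x /=; first by rewrite addr0.
by rewrite !IH -natr1; field.
Qed.

Lemma walkE_quart n x :
  walkE n (fun y => y ^+ 4) x = x ^+ 4 + 6 * n%:R * x ^+ 2 + 3 * n%:R ^+ 2 - 2 * n%:R.
Proof.
elim: n x => [|n IH] x /=; first by ring.
by rewrite !IH -natr1; field.
Qed.

Lemma walkE_exp n (l : R) x :
  walkE n (fun y => expR (l * y)) x = ((expR l + expR (- l)) / 2) ^+ n * expR (l * x).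
Proof.
elim: n x => [|n IH] x /=; first by rewrite expr0 mul1r.
by rewrite !IH mulrDr mulrBr mulr1 !expRD exprS; field.
Qed.

(** The bounds [e^m <= 1/(1 - m)] at [m = l] and [m = - l] average to [1/(1 - l^2)], at most
    [1 + 2 l^2] in this range. *)
Lemma cosh_le (l : R) : `|l| <= 2^-1 -> (expR l + expR (- l)) / 2 <= expR (2 * l ^+ 2).
Proof.
rewrite ler_norml => /andP[l1 l2].
have h (m : R) : m <= 2^-1 -> expR m <= (1 - m)^-1.
  move=> m2; rewrite -[leLHS]invrK lef_pV2 ?posrE ?invr_gt0 ?expR_gt0 //; last by lra.
  by rewrite -expRN; exact: expR_ge1Dx.
have h1 := h l l2; have h2 : expR (- l) <= (1 - - l)^-1 by apply: h; lra.
have h3 := expR_ge1Dx (2 * l ^+ 2).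
apply: le_trans h3; apply: (@le_trans _ _ (((1 - l)^-1 + (1 - - l)^-1) / 2)).
  by rewrite ler_pM2r ?invr_gt0 // lerD.
have -> : ((1 - l)^-1 + (1 - - l)^-1) / 2 = (1 - l ^+ 2)^-1.
  field; apply/and3P; split; apply/eqP; nra.
have l3 : l ^+ 2 <= 4^-1 by nra.
rewrite -[leLHS]mul1r ler_pdivrMr; [nra | lra].
Qed.

(** Chernoff bound at [l = t/(4n)], the minimiser of [- l t + 2 n l^2]; [t <= n] keeps [l] in the
    range of [cosh_le]. *)
Lemma walkE_upper n (t : R) : (0 < n)%N -> 0 <= t <= n%:R ->
  walkE n (fun y => (t <= y)%R%:R) 0 <= expR (- (t ^+ 2 / (8 * n%:R))).
Proof.
move=> n0 /andP[t0 tn]; have np : (0 : R) < n%:R by rewrite ltr0n.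
pose l := t / (4 * n%:R).
have l0 : 0 <= l by rewrite divr_ge0 // mulr_ge0.
have l1 : l <= 4^-1.
  by rewrite /l ler_pdivrMr ?mulr_gt0 //; lra.
apply: (@le_trans _ _ (walkE n (fun y => expR (- (l * t)) * expR (l * y) + 0 * expR (l * y)) 0)).
  apply: walkE_le => y; rewrite mul0r addr0 -expRD.
  case: (lerP t y) => [ty|_]; last exact: expR_ge0.
  have -> : - (l * t) + l * y = l * (y - t) by ring.
  apply: le_trans (expR_ge1Dx _); rewrite lerDl mulr_ge0 // subr_ge0 //.
rewrite walkE_lin mul0r addr0 walkE_exp mulr0 expR0 mulr1.
have hc := @cosh_le l; rewrite ger0_norm // in hc.
have {}hc := hc ltac:(lra).
have h1 : ((expR l + expR (- l)) / 2) ^+ n <= expR (n%:R * (2 * l ^+ 2)).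
  rewrite [n%:R * _]mulrC expRM_natr; apply: (lerXn2r _ _ _ hc); last exact: expR_ge0.
  by rewrite nnegrE divr_ge0 // addr_ge0 ?expR_ge0.
apply: (@le_trans _ _ (expR (- (l * t)) * expR (n%:R * (2 * l ^+ 2)))).
  by rewrite ler_pM2l ?expR_gt0.
rewrite -expRD ler_expR /l le_eqVlt; apply/orP; left; apply/eqP.
by field; rewrite gt_eqF.
Qed.

(* Paley-Zygmund: with z = y^2/n, the polynomial (z - 1/4)(8 - z)/16 is at most 1, and it is
   negative for z < 1/4, while its mean is at least 1/5 because E z = 1 and E z^2 <= 3. *)
Lemma walkE_lower n : (0 < n)%N ->
  10^-1 <= walkE n (fun y => (Num.sqrt n%:R / 2 <= y)%R%:R : R) 0.
Proof.
move=> n0; have np : (0 : R) < n%:R by rewrite ltr0n.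
set f := fun y => _.
have sn : Num.sqrt n%:R ^+ 2 = n%:R :> R by rewrite sqr_sqrtr // ltW.
have s0 : 0 <= Num.sqrt n%:R :> R by rewrite sqrtr_ge0.
have sym : walkE n (fun y => f (- y)) 0 = walkE n f 0 by rewrite walkE_opp oppr0.
(* Coefficients of the expanded polynomial. Its mean is at least [33/64 - 3/16 - 1/8 = 13/64]; as it
   bounds both tails together, symmetry leaves [13/128 > 1/10] for one. *)
pose A := 33 / 64 / n%:R : R; pose B := - (16^-1 / n%:R ^+ 2) : R.
have bnd y : 1 * (A * y ^+ 2 + B * y ^+ 4) + (- 8^-1) * 1 <= 1 * f y + 1 * f (- y).
  pose z := y ^+ 2 / n%:R.
  have -> : 1 * (A * y ^+ 2 + B * y ^+ 4) + (- 8^-1) * 1 = (z - 4^-1) * (8 - z) / 16.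
    by rewrite /A /B /z; field; rewrite gt_eqF.
  have z0 : 0 <= z by rewrite divr_ge0 // ?sqr_ge0 // ltW.
  have f0 w : 0 <= f w by rewrite /f ler0n.
  have [zs|zs] := ltrP z (4^-1).
    apply: (@le_trans _ _ 0); last by rewrite !mul1r addr_ge0.
    by nra.
  apply: (@le_trans _ _ 1); first by have := sqr_ge0 (z - 33 / 8); nra.
  have ys : (Num.sqrt n%:R / 2) ^+ 2 <= y ^+ 2.
    rewrite exprMn sn; move: zs; rewrite /z ler_pdivlMr // => zs.
    by rewrite exprVn; lra.
  have : (Num.sqrt n%:R / 2 <= y) || (Num.sqrt n%:R / 2 <= - y).
    move: ys; set c := Num.sqrt _ / 2; have c0 : 0 <= c by rewrite divr_ge0.
    move=> ys; case: (lerP c y) => //= h1; rewrite leNgt; apply/negP => h2.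
    by move: ys; apply/negP; rewrite -ltNge; nra.
  rewrite !mul1r /f => /orP[->|->]; rewrite mulr1n ?lerDl ?lerDr ?ler0n //.
have := walkE_le n 0 bnd.
rewrite (walkE_lin n 1 (- 8^-1) (fun y => A * y ^+ 2 + B * y ^+ 4) (fun=> 1)).
rewrite (walkE_lin n A B (fun y => y ^+ 2) (fun y => y ^+ 4)) walkE_sqr walkE_quart walkE_cst.
rewrite (walkE_lin n 1 1 f (fun y => f (- y))) sym => {}bnd.
have e1 : A * n%:R = 33 / 64 by rewrite /A; field; rewrite gt_eqF.
have e2 : B * n%:R ^+ 2 = - 16^-1 by rewrite /B; field; rewrite gt_eqF.
have B0 : B <= 0 by rewrite /B oppr_le0 divr_ge0 // exprn_ge0 // ltW.
have e3 : 0 <= B * (- 2 * n%:R) by nra.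
move: bnd; nra.
Qed.

End Walk.

(** * Uniform measure on finite spin assignments *)

Section Uniform.
Variables (R : realType) (I : finType).
Local Notation X := {ffun I -> bool}.
Local Notation sp := (spin R).

Definition EX (F : X -> R) : R := (\sum_v F v) / 2 ^+ #|I|.

Lemma two_pow_gt0 : 0 < (2 : R) ^+ #|I|. Proof. by rewrite exprn_gt0. Qed.

Lemma EX_le F G : (forall v, F v <= G v) -> EX F <= EX G.
Proof. by move=> FG; rewrite ler_pM2r ?invr_gt0 ?two_pow_gt0 //; apply: ler_sum. Qed.

Lemma EX_sum (T : Type) (r : seq T) (F : T -> X -> R) :
  EX (fun v => \sum_(i <- r) F i v) = \sum_(i <- r) EX (F i).
Proof. by rewrite /EX exchange_big mulr_suml. Qed.

Lemma EXD F G : EX (fun v => F v + G v) = EX F + EX G.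
Proof. by rewrite /EX big_split mulrDl. Qed.

Lemma EX1 : EX (fun=> 1) = 1.
Proof.
by rewrite /EX sumr_const card_ffun card_bool natrX divff // gt_eqF // two_pow_gt0.
Qed.

Definition spin_sum (s : seq I) (v : X) : R := \sum_(i <- s) sp (v i).

Definition indep_of (s : seq I) (G : X -> R) : Prop :=
  forall i, i \in s -> forall v : X, G (upd i (~~ v i) v) = G v.

Lemma spin_sum_flip s i (v : X) : i \notin s -> spin_sum s (upd i (~~ v i) v) = spin_sum s v.
Proof.
move=> nis; apply: eq_big_seq => j js; rewrite ffunE.
by case: eqP => // ji; rewrite -ji js in nis.
Qed.

(** Averaging [v] with its flip at [i] fixes [G] and the other spins and moves [x] to [x + 1] or
    [x - 1], which is one step of [walkE]. *)
Lemma walk_indep (s : seq I) (f : R -> R) (x : R) (G : X -> R) : uniq s -> indep_of s G ->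
  EX (fun v => f (x + spin_sum s v) * G v) = walkE (size s) f x * EX G.
Proof.
elim: s x => [|i s IH] x /=.
  move=> _ _; rewrite /EX mulrA; congr (_ / _); rewrite mulr_sumr.
  by apply: eq_bigr => v _; rewrite /spin_sum big_nil addr0.
move=> /andP[nis us] hG.
have hG' : indep_of s G by move=> j js; apply: hG; rewrite inE js orbT.
have hGi (v : X) : G (upd i (~~ v i) v) = G v by apply: hG; rewrite inE eqxx.
have -> : EX (fun v => f (x + spin_sum (i :: s) v) * G v) =
  EX (fun v => (f (x + 1 + spin_sum s v) * G v + f (x - 1 + spin_sum s v) * G v) / 2).
  rewrite /EX; congr (_ / _); apply: (@mulfI _ 2); first by rewrite pnatr_eq0.
  rewrite [RHS]mulr_sumr mulr_natl mulr2n.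
  rewrite -{1}(sum_flip i (fun v => f (x + spin_sum (i :: s) v) * G v)) -big_split /=.
  apply: eq_bigr => v _; rewrite hGi /spin_sum !big_cons -!/(spin_sum _ _) spin_sum_flip //.
  by rewrite ffunE eqxx !addrA; case: (v i); rewrite /spin /=; field.
have -> : EX (fun v => (f (x + 1 + spin_sum s v) * G v + f (x - 1 + spin_sum s v) * G v) / 2)
  = (EX (fun v => f (x + 1 + spin_sum s v) * G v) + EX (fun v => f (x - 1 + spin_sum s v) * G v)) / 2.
  by rewrite -EXD /EX -mulr_suml mulrAC.
by rewrite !IH //; ring.
Qed.

Lemma walk_EX (s : seq I) (f : R -> R) : uniq s ->
  EX (fun v => f (spin_sum s v)) = walkE (size s) f 0.
Proof.
move=> us; have := @walk_indep s f 0 (fun=> 1) us (fun _ _ _ => erefl).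
rewrite EX1 mulr1 => <-; congr EX; apply/funext => v.
by rewrite add0r mulr1.
Qed.

(** Independence of disjoint blocks: the product over the remaining blocks plays the role of [G] in
    [walk_indep]. *)
Lemma blocks_EX (bs : seq (seq I)) (f : R -> R) (n : nat) :
  uniq (flatten bs) -> all (fun s => size s == n) bs ->
  EX (fun v => \prod_(s <- bs) f (spin_sum s v)) = walkE n f 0 ^+ size bs.
Proof.
elim: bs => [|s bs IH] /=.
  by move=> _ _; rewrite expr0 -[RHS]EX1; congr EX; apply/funext => v; rewrite big_nil.
rewrite cat_uniq => /and3P[us /hasPn dis ub] /andP[/eqP sn al].
have hG : indep_of s (fun v => \prod_(s <- bs) f (spin_sum s v)).
  move=> i si v; apply: eq_big_seq => t tb; rewrite spin_sum_flip //.
  apply/negP => it; have if_ : i \in flatten bs by apply/flattenP; exists t.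
  by have := dis i if_; rewrite /= si.
have := walk_indep f 0 us hG; rewrite IH // sn exprS => <-.
by congr EX; apply/funext => v; rewrite big_cons add0r.
Qed.

End Uniform.

Lemma spin_inj (R : realType) : injective (spin R).
Proof. by case=> -[] //; rewrite /spin => e; exfalso; lra. Qed.

(** * Probability that the random field is good *)

Section FieldCounting.
Variables (R : realType) (r : nat).
Local Notation Lam n := 'I_(n.*2).+1.
Local Notation X := {ffun Lam r -> bool}.
Local Notation sp := (spin R).

Definition field_of (v : X) (z : int) : R := sp (ext plus_bc v z).
Definition box_index (z : int) : Lam r := inord (absz (z + r%:Z)%R).

Lemma field_of_sum (s : seq int) (v : X) : {subset s <= box r} ->
  \sum_(z <- s) field_of v z = spin_sum R (map box_index s) v.
Proof.
move=> sub; rewrite /spin_sum big_map; apply: eq_big_seq => z /sub zb.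
by rewrite /field_of /ext /inLam -mem_box zb.
Qed.

Lemma uniq_box_index (s : seq int) : {subset s <= box r} -> uniq s -> uniq (map box_index s).
Proof.
move=> sub us; rewrite map_inj_in_uniq // => x y /sub; rewrite mem_box => xb /sub.
rewrite mem_box => yb /(congr1 val) /=; rewrite !inordK; lia.
Qed.

Lemma small_EX (a : int) (L : nat) (t : R) : (0 < L)%N -> 0 <= t ->
  {subset zint a L <= box r} ->
  EX (fun v : X => (t < `|\sum_(z <- zint a L) field_of v z|)%R%:R) <=
    2 * expR (- (t ^+ 2 / (8 * L%:R))).
Proof.
move=> L0 t0 sub; have us := uniq_box_index sub (zint_uniq a L).
(* A sum of [L] signs never exceeds [t > L]; the range [t <= L] is that of [walkE_upper]. *)
have [tL|tL] := lerP t L%:R; last first.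
  apply: (@le_trans _ _ 0); last by rewrite mulr_ge0 ?expR_ge0.
  rewrite /EX big1 ?mul0r // => v _.
  rewrite ltNge (_ : _ <= t) //; apply: le_trans (ltW tL).
  apply: le_trans (ler_norm_sum _ _ _) _.
  rewrite (eq_bigr (fun=> 1)); last first.
    by move=> z _; rewrite /field_of /spin; case: ifP; rewrite ?normrN normr1.
  by rewrite big_const_seq count_predT size_zint iter_addr_0.
apply: (@le_trans _ _ (EX (fun v : X => (t <= spin_sum R (map box_index (zint a L)) v)%R%:R
    + (t <= - spin_sum R (map box_index (zint a L)) v)%R%:R))).
  apply: EX_le => v; rewrite field_of_sum //.
  case: (ltrP t) => [|_]; last by rewrite addr_ge0.
  rewrite ltr_normr => /orP[] /ltW ->; first by rewrite lerDl.
  by rewrite lerDr.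
rewrite EXD (walk_EX (fun y => (t <= y)%R%:R) us) (walk_EX (fun y => (t <= - y)%R%:R) us).
rewrite (walkE_opp _ (fun y => (t <= y)%R%:R)) oppr0 size_map size_zint.
have := @walkE_upper R L t L0; rewrite t0 tL => /(_ isT); lra.
Qed.

Lemma zint_flatten a K ell :
  zint a (K * ell) = flatten [seq zint (a + (k * ell)%:Z) ell | k <- iota 0 K].
Proof.
elim: K => [|K IH] //.
rewrite mulSn addnC zint_cat IH -[K.+1]addn1 iotaD map_cat flatten_cat /=.
by rewrite add0n cats0.
Qed.

Lemma large_EX (a : int) (K ell : nat) (b : bool) : (0 < ell)%N ->
  {subset zint a (K * ell) <= box r} ->
  EX (fun v : X => [forall k : 'I_K, ~~ (sp b * \sum_(z <- zint (a + (k * ell)%:Z) ell)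
         field_of v z <= - (Num.sqrt ell%:R / 2))%R]%:R : R) <= (9 / 10) ^+ K.
Proof.
move=> ell0 sub.
pose bs := [seq map box_index (zint (a + (k * ell)%:Z) ell) | k <- iota 0 K].
have ub : uniq (flatten bs).
  rewrite /bs (map_comp (map box_index) (fun k => zint (a + (k * ell)%:Z) ell)).
  by rewrite -map_flatten -zint_flatten uniq_box_index // zint_uniq.
have sb : all (fun s => size s == ell) bs.
  by apply/allP => s /mapP[k _ ->]; rewrite size_map size_zint.
(* Indicator that a block fails, in the shape required by [walkE_lin]; its mean is at most
   [9/10]. *)
pose f (y : R) := 1 * 1 + (-1) * (Num.sqrt ell%:R / 2 <= - (sp b * y))%R%:R : R.
apply: (@le_trans _ _ (EX (fun v : X => \prod_(s <- bs) f (spin_sum R s v)))).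
  apply: EX_le => v; rewrite /bs big_map.
  have -> : iota 0 K = index_iota 0 K by rewrite /index_iota subn0.
  rewrite big_mkord.
  have f01 y : 0 <= f y by rewrite /f; case: (Num.sqrt _ / 2 <= _); rewrite /=; lra.
  case: forallP => [all_|_]; last by rewrite prodr_ge0.
  rewrite big1 // => k _.
  have := all_ k; rewrite field_of_sum; last first.
    move=> z zk; apply: sub; move: zk; rewrite !mem_zint => zk.
    have : (k * ell + ell <= K * ell)%N by rewrite addnC -mulSn leq_mul2r ltn_ord orbT.
    by lia.
  by rewrite /f lerNr => /negbTE ->; rewrite mulr0 addr0 mulr1.
rewrite (blocks_EX f ub sb) size_map size_iota.
have w1 : walkE ell f 0 = 1 - walkE ell (fun y => (Num.sqrt ell%:R / 2 <= y)%R%:R : R) 0.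
  rewrite /f (walkE_lin _ 1 (-1) (fun=> 1) (fun y => (Num.sqrt ell%:R / 2 <= - (sp b * y))%R%:R)).
  rewrite walkE_cst mul1r mulN1r; congr (_ - _).
  case: b {f}; rewrite /spin.
    under [in LHS]eq_fun do rewrite mul1r.
    by rewrite (walkE_opp _ (fun y => (Num.sqrt ell%:R / 2 <= y)%R%:R)) oppr0.
  by under [in LHS]eq_fun do rewrite mulN1r opprK.
have w2 := walkE_lower R ell0.
apply: lerXn2r; rewrite ?nnegrE; [|lra|lra].
rewrite -[leLHS](walkE_cst ell (0 : R) 0); apply: walkE_le => y.
by rewrite /f; case: (Num.sqrt _ / 2 <= _); rewrite /=; lra.
Qed.

Variables (theta : R) (G : nat -> R) (c x : R) (lmin ell K r1 : nat).
Hypothesis theta0 : 0 < theta.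
Hypothesis rE : r = (r1 + lmin + K * ell)%N.
Hypothesis ell0 : (0 < ell)%N.
Hypothesis G_ge0 : forall L, (0 < L)%N -> 0 <= G L.
Hypothesis small : forall L, (0 < L <= lmin)%N -> x <= (G L / theta) ^+ 2 / (8 * L%:R).
Hypothesis large : c <= theta * (Num.sqrt ell%:R / 2).
Hypothesis blocks : (9 / 10) ^+ K <= expR (- x).

Definition good_field (f : int -> R) : Prop :=
  field_small theta f G lmin r1 /\ field_large theta f c K ell r1.

(** Union bound: for each start [a], [lmin] lengths at [2 e^(-x)] each and two spins [b] at [e^(-x)]
    each. *)
Lemma bad_field_EX :
  EX (fun v : X => (~~ `[< good_field (field_of v) >])%:R : R) <=
    ((2 * r1 + 1) * (2 * lmin + 2))%:R * expR (- x).
Proof.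
pose S (v : X) a L := \sum_(z <- zint a L) field_of v z.
pose B1 (v : X) (a : int) (L : nat) := (G L / theta < `|S v a L|)%R.
pose B2 (v : X) (a : int) (b : bool) := [forall k : 'I_K,
   ~~ (sp b * S v (a + (k * ell)%:Z) ell <= - (Num.sqrt ell%:R / 2))%R].
apply: (@le_trans _ _ (EX (fun v : X => \sum_(a <- box r1)
   (\sum_(L <- iota 1 lmin) (B1 v a L)%:R + \sum_(b <- [:: true; false]) (B2 v a b)%:R)))).
  apply: EX_le => v.
  have pos (a : int) : 0 <= \sum_(L <- iota 1 lmin) (B1 v a L)%:R
      + \sum_(b <- [:: true; false]) (B2 v a b)%:R :> R.
    by rewrite addr_ge0 // sumr_ge0.
  case: asboolP => [_|bad] /=; first by rewrite sumr_ge0.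
  have one (T : eqType) (s : seq T) (F : T -> R) (i : T) : i \in s -> (forall j, 0 <= F j) ->
      1 <= F i -> 1 <= \sum_(j <- s) F j.
    move=> si F0 Fi; apply: le_trans Fi _; elim: s si => // j s IH.
    rewrite inE big_cons => /orP[/eqP <-|/IH le]; first by rewrite lerDl sumr_ge0.
    by apply: le_trans le _; rewrite lerDr.
  have inbox (a : int) : `|a| <= r1%:Z -> a \in box r1 by rewrite mem_box; lia.
  have [sm|/existsNP[a /existsNP[L /not_implyP[ar /not_implyP[Ll bd]]]]] :=
      pselect (field_small theta (field_of v) G lmin r1).
    have /existsNP[a /existsNP[b /not_implyP[ar bd]]] :
      ~ field_large theta (field_of v) c K ell r1 by move=> lg; apply: bad.
    apply: (one _ _ _ a (inbox a ar) pos).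
    apply: (@le_trans _ _ (\sum_(b <- [:: true; false]) (B2 v a b)%:R)); last first.
      by rewrite lerDr sumr_ge0.
    apply: (one _ _ _ b); [by case: (b)|by []|].
    rewrite (_ : B2 v a b) //; apply/forallP => k; apply/negP => le.
    apply: bd; exists k => //.
    have := ler_wpM2l (ltW theta0) le; rewrite mulrN -/(S v _ _).
    by move: large; lra.
  apply: (one _ _ _ a (inbox a ar) pos).
  apply: (@le_trans _ _ (\sum_(L <- iota 1 lmin) (B1 v a L)%:R)); last first.
    by rewrite lerDl sumr_ge0.
  apply: (one _ _ _ L); [by rewrite mem_iota; lia|by []|].
  rewrite (_ : B1 v a L) // /B1 ltr_pdivrMr // mulrC ltNge; exact/negP.
rewrite EX_sum mulnC natrM -mulrA mulrCA.
have -> : (2 * r1 + 1)%:R = \sum_(a <- box r1) (1 : R).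
  rewrite big_const_seq count_predT size_zint iter_addr_0; congr (_%:R); lia.
rewrite mulr_suml big_seq [leRHS]big_seq; apply: ler_sum => a; rewrite mem_box => ar.
rewrite EXD !EX_sum mul1r natrD mulrDl; apply: lerD.
  have -> : (2 * lmin)%:R * expR (- x) = \sum_(L <- iota 1 lmin) (2 * expR (- x)).
    by rewrite big_const_seq count_predT size_iota iter_addr_0 natrM -mulr_natl; ring.
  rewrite big_seq [leRHS]big_seq; apply: ler_sum => L; rewrite mem_iota => hL.
  have L0 : (0 < L <= lmin)%N by lia.
  have L1 : (0 < L)%N by lia.
  apply: (le_trans (small_EX L1 _ _)).
  - by rewrite divr_ge0 ?G_ge0 // ltW.
  - by move=> z; rewrite mem_zint mem_box rE; lia.
  - by rewrite ler_pM2l // ler_expR lerN2 small.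
have -> : 2%:R * expR (- x) = \sum_(b <- [:: true; false]) expR (- x).
  by rewrite !big_cons big_nil; ring.
apply: ler_sum => b _; apply: le_trans blocks; apply: large_EX => //.
by move=> z; rewrite mem_zint mem_box rE; lia.
Qed.

Variables (d : measure_display) (T : measurableType d) (P : probability T R).
Variable h : int -> T -> R.
Hypothesis iid : iid_sym_signs P h.

(** Distinct patterns give disjoint events of equal probability, so counting patterns computes
    probabilities. *)
Definition field_cyl (v : X) : set T :=
  \bigcap_(i in [set` box r]) [set w | h i w = field_of v i].

Lemma measurable_field_eq i (y : R) : measurable [set w | h i w = y].
Proof.
case: iid => mh _ _.
have -> : [set w | h i w = y] = setT `&` h i @^-1` [set y] by rewrite setTI.
by apply: mh => //; exact: measurable_set1.
Qed.

Lemma measurable_field_cyl v : measurable (field_cyl v).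
Proof.
by apply: fin_bigcap_measurable => [|i _]; [exact: finite_seq|exact: measurable_field_eq].
Qed.

Lemma prob_field_cyl v : P (field_cyl v) = ((2 ^+ #|{: Lam r}|)^-1)%:E.
Proof.
case: iid => _ half ind; rewrite /field_cyl (ind (box r) (field_of v) (zint_uniq _ _)).
rewrite (eq_bigr (fun=> (2^-1 : R)%:E)); last first.
  by move=> i _; rewrite /field_of /spin; case: ifP => _; case: (half i).
have -> : #|{: Lam r}| = size (box r) by rewrite card_ord size_zint.
elim: (box r) => [|z s IH]; first by rewrite big_nil expr0 invr1.
by rewrite big_cons IH -EFinM /= exprS invfM.
Qed.

Lemma prob_cyl_union (s : seq X) : uniq s ->
  P (\big[setU/set0]_(v <- s) field_cyl v) = ((size s)%:R / 2 ^+ #|{: Lam r}|)%:E.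
Proof.
elim: s => [|v s IH] /=; first by rewrite big_nil measure0 mul0r.
move=> /andP[vs us]; rewrite big_cons.
transitivity (P (field_cyl v) + P (\big[setU/set0]_(v <- s) field_cyl v))%E; last first.
  by rewrite IH // prob_field_cyl -EFinD -[(size s).+1%:R]natr1 mulrDl mul1r addrC.
apply: measureU.
- exact: measurable_field_cyl.
- by apply: bigsetU_measurable => u _; exact: measurable_field_cyl.
apply/seteqP; split => // w [cv]; rewrite -bigcup_seq => -[u /= us' cu].
have uv : u = v.
  apply/ffunP => i; have ib : site i \in box r.
    by rewrite mem_box /site; have := ltn_ord i; lia.
  have := cv _ ib; rewrite /= (cu _ ib) /field_of !ext_site; exact: spin_inj.
by rewrite -uv us' in vs.
Qed.

(** [A] is the union of the cylinders of good patterns, hence measurable by construction; the box of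
    radius [r] contains every interval that [good_field] inspects. *)
Lemma good_field_prob : exists A : set T, [/\ measurable A,
  ((1 - ((2 * r1 + 1) * (2 * lmin + 2))%:R * expR (- x))%:E <= P A)%E &
  forall w, A w -> good_field (fun i => h i w)].
Proof.
pose good (v : X) := `[< good_field (field_of v) >].
pose s := [seq v <- enum X | good v].
exists (\big[setU/set0]_(v <- s) field_cyl v); split.
- by apply: bigsetU_measurable => u _; exact: measurable_field_cyl.
- rewrite prob_cyl_union; last by rewrite filter_uniq // enum_uniq.
  rewrite lee_fin lerBlDr -[leLHS](EX1 R (Lam r)).
  have -> : (size s)%:R / 2 ^+ #|{: Lam r}| = EX (fun v : X => (good v)%:R : R).
    rewrite /EX; congr (_ / _); rewrite -sum1_size big_filter big_enum_cond /= natr_sum.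
    by rewrite [LHS]big_mkcond; apply: eq_bigr => v _; case: (good v).
  apply: le_trans (lerD (lexx _) bad_field_EX); rewrite -EXD; apply: EX_le => v.
  by rewrite -/(good v); case: (good v); rewrite /= ?addr0 ?add0r.
move=> w; rewrite -bigcup_seq => -[v /=]; rewrite mem_filter => /andP[/asboolP[sm lg] _] cw.
have eqh (a : int) L : {subset zint a L <= box r} ->
    \sum_(i <- zint a L) h i w = \sum_(i <- zint a L) field_of v i.
  by move=> sub; apply: eq_big_seq => z /sub zb; exact: cw.
split.
  move=> a L ar Ll; rewrite eqh; first exact: sm.
  by move=> z; rewrite mem_zint mem_box rE; lia.
move=> a b ar; have [k kK le] := lg a b ar; exists k => //.
rewrite eqh // => z; rewrite mem_zint mem_box rE => hz.
have : (k * ell + ell <= K * ell)%N by rewrite addnC -mulSn leq_mul2r kK orbT.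
by lia.
Qed.

End FieldCounting.

(** * Typical configurations *)

Section Core.
Variable R : realType.

(** One exponent [x] serves all errors: [10 x <= K] gives [(9/10)^K <= e^(-x)], and [x <= beta]
    gives [e^(-2 beta) <= e^(-x)]. Both union bounds have at most [33 M^3 <= M^4] terms, [M]
    bounding every length. *)
Lemma runs_ok_typical (alpha J1 theta beta D lo hi sc c x err M : R)
    (lmin ell K v : nat) (G : nat -> R)
    (d : measure_display) (T : measurableType d) (P : probability T R) (h : int -> T -> R) :
  0 <= alpha < 1 -> 0 <= J1 -> 0 < theta ->
  (forall L : nat, sc * L%:R < lo -> (L <= lmin)%N) ->
  (forall L : nat, hi < sc * L%:R -> (K * ell <= L)%N) ->
  (forall z, centered_interval D z -> `|z| <= v%:Z) ->
  (0 < ell)%N ->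
  (forall L q, (0 < L)%N -> (L <= q)%N ->
     Cut (Jint alpha J1) L q - 2 * Cut (Jint alpha J1) L L <= - G L) ->
  (forall L, (0 < L)%N -> 1 <= G L) ->
  (forall q, Cut (Jint alpha J1) ell q <= c) ->
  (forall L, (0 < L <= lmin)%N -> x <= (G L / theta) ^+ 2 / (8 * L%:R)) ->
  2 * c + 1 <= theta * (Num.sqrt ell%:R / 2) ->
  10 * x <= K%:R ->
  lmin%:R <= M -> ell%:R <= M -> (K * ell)%:R <= M -> v%:R <= M -> 33 <= M ->
  M ^+ 4 * expR (- x) <= err -> 0 <= x -> x <= beta ->
  iid_sym_signs P h ->
  exists A : set T, [/\ measurable A, ((1 - err)%:E <= P A)%E &
    forall w, A w -> exists l : R,
      (fun n : nat => gibbs_prob alpha J1 theta beta (fun i => h i w) n plus_bc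
                         (runs_ok D lo hi sc)) @ \oo --> l
      /\ 1 - err <= l].
Proof.
move=> a01 J10 t0 hlo hhi hv ell0 near G1 cost small large hK lM eM KM vM M33 Merr x0 xb iid.
pose r1 := (v + lmin * lmin)%N.
have M0 : 0 <= M by lra.
have l0 : (0 : R) <= lmin%:R by [].
have ll : (lmin * lmin)%:R <= M ^+ 2 :> R.
  by rewrite natrM expr2 ler_pM.
have MM : 33 * M <= M ^+ 2 by rewrite expr2 ler_wpM2r.
have M3 : 33 * M ^+ 3 <= M ^+ 4 by rewrite [leRHS]exprS ler_wpM2r // exprn_ge0.
have blocks : (9 / 10) ^+ K <= expR (- x).
  apply: (@le_trans _ _ (expR (- 10^-1 * K%:R))); last by rewrite ler_expR; lra.
  rewrite expRM_natr; apply: lerXn2r; rewrite ?nnegrE ?expR_ge0 //.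
  by have := expR_ge1Dx (- 10^-1 : R); lra.
have G0 L : (0 < L)%N -> 0 <= G L by move=> /G1; lra.
have [A [mA PA gA]] := @good_field_prob R (r1 + lmin + K * ell) theta G (2 * c + 1) x
  lmin ell K r1 t0 erefl ell0 G0 small large blocks d T P h iid.
exists A; split => //.
  apply: le_trans PA; rewrite lee_fin lerD2l lerN2; apply: le_trans Merr.
  rewrite ler_pM2r ?expR_gt0 //; apply: le_trans M3.
  have -> : 33 * M ^+ 3 = (11 * M ^+ 2) * (3 * M) by ring.
  rewrite natrM; apply: ler_pM => //.
    by rewrite /r1 !natrD !natrM in ll *; lra.
  by rewrite natrD natrM; lra.
move=> w /gA[fs fl].
have cvg := @local_cvg R alpha J1 theta beta (fun i => h i w) a01 J10 (le_trans x0 xb)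
   v.+1 _ (@runs_ok_local R D lo hi sc v hv).
exists (limn (fun n => gibbs_prob alpha J1 theta beta (fun i => h i w) n plus_bc
                         (runs_ok D lo hi sc))); split; first exact: cvg.
pose r := (v + lmin * lmin + 2 * lmin + K * ell)%N.
apply: limr_ge => //; exists r => // n /= rn.
have fl' : field_large theta (h^~ w) (2 * c + 1) K ell v.
  by move=> a b ar; apply: fl; apply: le_trans ar _; rewrite lez_nat leq_addr.
have := gibbs_runs a01 J10 (le_trans x0 xb) (ltW t0) hlo hhi hv ell0 near G1 cost fs fl' rn.
apply: le_trans; rewrite lerD2l lerN2; apply: le_trans Merr.
apply: ler_pM => //; rewrite ?expR_ge0 //; last by rewrite ler_expR; lra.
apply: le_trans M3.
have -> : 33 * M ^+ 3 = (11 * M ^+ 2) * (3 * M) by ring.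
rewrite natrM; apply: ler_pM => //.
  by rewrite !natrD !natrM in ll KM *; lra.
by rewrite !natrD; lra.
Qed.

Lemma truncn_gt (y : R) (L : nat) : L%:R < y -> (L <= Num.truncn y)%N.
Proof.
move=> Ly; have y0 : 0 <= y by apply: le_trans (ltW Ly).
by rewrite -ltnS -(ltr_nat R); have /andP[_] := truncn_itv y0; apply: lt_trans.
Qed.

Lemma centered_bound (D : R) z : 0 <= D -> centered_interval D z ->
  `|z| <= (Num.truncn (D / 2)).+1%:Z.
Proof.
move=> D0 hz.
have : (absz z)%:R < (Num.truncn (D / 2)).+1%:R :> R.
  have /andP[_] := truncn_itv (divr_ge0 D0 (ler0n R 2)); apply: le_lt_trans.
  by move: hz; rewrite /centered_interval /= -intr_norm -abszE.
by rewrite ltr_nat; lia.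
Qed.

End Core.

(** * Choice of scales for positive [alpha] *)

Section Asymptotics.
Variable R : realType.
Implicit Types (u x y : R).

Lemma sqr_le_expR (C u : R) : 1 <= u -> 16 * C <= u -> C * u ^+ 2 <= expR (2 * u).
Proof.
move=> u1 Cu.
have -> : 2 * u = u / 2 * 4%:R by field.
rewrite expRM_natr.
have h1 : u / 2 <= expR (u / 2) by have := expR_ge1Dx (u / 2); lra.
have h2 : (u / 2) ^+ 4 <= expR (u / 2) ^+ 4.
  by apply: lerXn2r; rewrite ?nnegrE ?expR_ge0 //; lra.
apply: le_trans h2.
have -> : (u / 2) ^+ 4 = (u ^+ 2 / 16) * u ^+ 2 by field.
rewrite ler_wpM2r ?sqr_ge0 //; nra.
Qed.

Lemma le_expR u : u <= expR u.
Proof. by have := expR_ge1Dx u; lra. Qed.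

Lemma ln_le u : 0 < u -> ln u <= u.
Proof. by move=> u0; have := le_expR (ln u); rewrite lnK. Qed.

Lemma sqrt_expR s : Num.sqrt (expR s) = expR (s / 2) :> R.
Proof.
have -> : expR s = expR (s / 2) ^+ 2 by rewrite expr2 -expRD; congr expR; field.
by rewrite sqrtr_sqr ger0_norm // expR_ge0.
Qed.

Lemma truncn_S_bounds y : 1 <= y ->
  y <= (Num.truncn y).+1%:R :> R /\ (Num.truncn y).+1%:R <= 2 * y :> R.
Proof.
move=> y1; have y0 : 0 <= y by lra.
have /andP[h1 h2] := truncn_itv y0; split; first exact: ltW.
by rewrite -natr1; lra.
Qed.

(** [2^alpha <= sqrt 2 < 3/2]. *)
Lemma zeta_gt0 (alpha : R) : 0 <= alpha < 2^-1 -> 0 < 1 - 2 * (2 `^ alpha - 1).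
Proof.
move=> /andP[a0 a1].
have h : (2 `^ alpha) ^+ 2 <= 2 :> R.
  rewrite -powR_mulrn ?powR_ge0 // -powRrM -[leRHS](powRr1 (ler0n R 2)).
  by rewrite ler_powR //; lra.
have := powR_ge0 2 alpha; nra.
Qed.

(** The threshold on [J1] absorbs the constants of [Cut_near_far] and leaves the summand 1. *)
Lemma near_far_pos (alpha J1 : R) (L q : nat) : 0 < alpha < 2^-1 ->
  2 + (2 + alpha^-1) / (1 - alpha) <= J1 -> (0 < L)%N -> (L <= q)%N ->
  Cut (Jint alpha J1) L q - 2 * Cut (Jint alpha J1) L L <=
    - (1 + (1 - 2 * (2 `^ alpha - 1)) / (alpha * (1 - alpha)) * L%:R `^ alpha).
Proof.
move=> /andP[a0 a1] hJ L0 Lq.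
have a01 : 0 <= alpha < 1 by lra.
apply: le_trans (Cut_near_far a01 J1 L0 Lq) _.
rewrite /antideriv (gt_eqF a0) powR1 powRM ?ler0n //.
set X := L%:R `^ alpha; set t := 2 `^ alpha.
have -> : (2 + 1 / alpha + 2 * (t * X / alpha) - 3 * (X / alpha)) / (1 - alpha)
  = (2 + alpha^-1) / (1 - alpha) - (1 - 2 * (t - 1)) / (alpha * (1 - alpha)) * X.
  by field; apply/andP; split; apply/eqP; lra.
by lra.
Qed.

Lemma near_far_zero (J1 : R) (L q : nat) : 4 + 2 * ln 2 <= J1 -> (0 < L)%N -> (L <= q)%N ->
  Cut (Jint 0 J1) L q - 2 * Cut (Jint 0 J1) L L <= - (1 + ln L%:R).
Proof.
move=> hJ L0 Lq.
have a01 : 0 <= (0 : R) < 1 by lra.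
apply: le_trans (Cut_near_far a01 J1 L0 Lq) _.
rewrite /antideriv eqxx ln1 lnM ?posrE ?ltr0n // subr0 divr1; lra.
Qed.

(** With [theta = e^(-u)] and [L = e^s] the Chernoff exponent is at least
    [cg^2/8 * e^(2u - (1 - 2 alpha) s)]. The bound on [s], which carries the logarithms of the lower
    bound on runs, makes this at least [cg^2/8 * u^2 y]; the spare factor [u] beats [8 Q / cg^2]. *)
Lemma small_field_pos (alpha cg Q p u y z s : R) : 0 < cg -> 0 < 1 - 2 * alpha ->
  p * (1 - 2 * alpha) = 2 -> u = expR y -> y = expR z ->
  s <= p * u - p * y - p / 2 * z -> 8 * Q <= cg ^+ 2 * u ->
  Q * (u * y) <= ((1 + cg * expR (s * alpha)) / expR (- u)) ^+ 2 / (8 * expR s).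
Proof.
move=> cg0 b0 pb uE yE sle ucg.
have s2 : (1 - 2 * alpha) * s <= 2 * u - 2 * y - z.
  apply: (le_trans (ler_wpM2l (ltW b0) sle)).
  have -> : (1 - 2 * alpha) * (p * u - p * y - p / 2 * z) =
     (p * (1 - 2 * alpha)) * (u - y - z / 2) by field.
  by rewrite pb; lra.
have Gle : cg * expR (s * alpha) * expR u <= (1 + cg * expR (s * alpha)) / expR (- u).
  by rewrite -expRN opprK ler_pM2r ?expR_gt0 // lerDr.
have G2 : (cg * expR (s * alpha) * expR u) ^+ 2 <= ((1 + cg * expR (s * alpha)) / expR (- u)) ^+ 2.
  have G0 : 0 <= cg * expR (s * alpha) * expR u by rewrite !mulr_ge0 ?expR_ge0 // ltW.
  by apply: lerXn2r => //; rewrite nnegrE //; apply: le_trans Gle.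
have G3 : cg ^+ 2 / 8 * expR (2 * y + z) <= (cg * expR (s * alpha) * expR u) ^+ 2 / (8 * expR s).
  have -> : (cg * expR (s * alpha) * expR u) ^+ 2 / (8 * expR s) =
     cg ^+ 2 / 8 * (expR (s * alpha) ^+ 2 * expR u ^+ 2 / expR s).
    by field; rewrite gt_eqF // expR_gt0.
  rewrite ler_pM2l; last by rewrite divr_gt0 // exprn_gt0.
  by rewrite !expr2 -expRN -!expRD ler_expR; lra.
apply: le_trans (le_trans G3 _); last by rewrite ler_pM2r // invr_gt0 mulr_gt0 // expR_gt0.
rewrite expRD -yE.
have -> : expR (2 * y) = u ^+ 2 by rewrite mulrC expRM_natr -uE.
have uy : 0 <= u * y by rewrite uE {2}yE mulr_ge0 ?expR_ge0.
have := ler_wpM2r uy ucg; clear; lra.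
Qed.

(** With [ell = e^s] the level is at most [CJ * ell^alpha], and [theta * sqrt ell / 2] reaches it
    once [(1/2 - alpha) s >= u + kap]; since [p (1 - 2 alpha) = 2], this is the hypothesis on
    [s]. *)
Lemma large_field_pos (alpha J1 p u kap s : R) : 0 < alpha -> 0 < 1 - 2 * alpha ->
  0 <= J1 -> 0 <= s -> p * (1 - 2 * alpha) = 2 -> p * kap + p * u <= s ->
  2 * (2 * (J1 + (3 + alpha^-1) / (1 - alpha)) + 1) <= expR kap ->
  2 * (J1 + (3 + expR (s * alpha) / alpha) / (1 - alpha)) + 1 <=
    expR (- u) * (expR (s / 2) / 2).
Proof.
move=> a0 b0 J10 s0 pb s1; set CJ := 2 * (J1 + _) + 1 => hkap.
have hc : 2 * (J1 + (3 + expR (s * alpha) / alpha) / (1 - alpha)) + 1 <= CJ * expR (s * alpha).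
  have : 1 <= expR (s * alpha) by rewrite -[leLHS]expR0 ler_expR mulr_ge0 // ltW.
  rewrite /CJ; set e := expR _ => e1.
  have -> : (3 + e / alpha) / (1 - alpha) = 3 / (1 - alpha) + alpha^-1 / (1 - alpha) * e.
    by field; apply/andP; split; apply/eqP; lra.
  have -> : (3 + alpha^-1) / (1 - alpha) = 3 / (1 - alpha) + alpha^-1 / (1 - alpha) by ring.
  have : 0 <= 3 / (1 - alpha) by rewrite divr_ge0 //; lra.
  move: (alpha^-1 / (1 - alpha)) (3 / (1 - alpha)) J10 e1 => a3 b3; clear => J10 e1 b30.
  have := ler_wpM2l b30 e1; have := ler_wpM2l J10 e1; nra.
apply: (le_trans hc).
have -> : expR (- u) * (expR (s / 2) / 2) = expR (s / 2 - u - s * alpha) / 2 * expR (s * alpha).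
  by rewrite !expRD !expRN; field; rewrite ?gt_eqF ?expR_gt0.
rewrite ler_pM2r ?expR_gt0 // ler_pdivlMr // mulrC.
apply: (le_trans hkap); rewrite ler_expR.
have := ler_wpM2l (ltW b0) s1.
have -> : (1 - 2 * alpha) * (p * kap + p * u) = (p * (1 - 2 * alpha)) * (kap + u) by ring.
by rewrite pb; lra.
Qed.

(** With [theta = e^(-u)] the right-hand side is [zeta e^(2u) / 256], exponential in [u], while [x]
    is at most quadratic. *)
Lemma temperature_bound (zeta Q u x : R) : 0 < zeta -> 1 <= u ->
  16 * (256 * Q / zeta) <= u -> x <= Q * u ^+ 2 -> x <= zeta / (2 ^+ 8 * expR (- u) ^+ 2).
Proof.
move=> zp u1 uz xQ.
rewrite ler_pdivlMr; last by rewrite mulr_gt0 // ?exprn_gt0 // expR_gt0.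
have hs := sqr_le_expR u1 uz.
have -> : expR (- u) ^+ 2 = (expR (2 * u))^-1.
  by rewrite -expRN expr2 -expRD; congr expR; ring.
rewrite mulrA ler_pdivrMr ?expR_gt0 //.
have : 256 * Q * u ^+ 2 <= zeta * expR (2 * u).
  have := ler_wpM2l (ltW zp) hs.
  have -> : zeta * (256 * Q / zeta * u ^+ 2) = 256 * Q * u ^+ 2 by field; rewrite gt_eqF.
  by [].
apply: le_trans.
have -> : 2 ^+ 8 = 256 :> R by ring.
by move: xQ; clear; lra.
Qed.

Lemma block_count_bounds x : 1 <= x ->
  10 * x <= (Num.truncn (10 * x)).+1%:R :> R /\ (Num.truncn (10 * x)).+1%:R <= 11 * x :> R.
Proof.
move=> x1; have x0 : 0 <= 10 * x by lra.
have /andP[h1 h2] := truncn_itv x0; split; first exact: ltW.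
by rewrite -natr1; lra.
Qed.

Lemma half_truncn_le x : 1 <= x -> (Num.truncn (x / 2)).+1%:R <= 2 * x :> R.
Proof.
move=> x1; have x0 : 0 <= x / 2 by lra.
by have /andP[h1 h2] := truncn_itv x0; rewrite -natr1; lra.
Qed.

(* Writing u = log(1/theta) and y = log log(1/theta), a run is flipped as soon as it is shorter
   than lmin; among K ~ u y consecutive blocks of length ell ~ K0 theta^(-p), one has a field sum
   of order sqrt ell and of the prescribed sign, and ell is chosen so that
   theta sqrt ell exceeds the cost ~ ell^alpha of flipping the block. *)
Lemma typical_pos (alpha J1 : R) : 0 < alpha < 2^-1 ->
  2 + (2 + alpha^-1) / (1 - alpha) <= J1 ->
  exists U c2 : R, 0 < c2 /\
  forall (d : measure_display) (T : measurableType d) (P : probability T R) (h : int -> T -> R),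
  iid_sym_signs P h -> forall u beta : R, U <= u ->
  (1 - 2 * (2 `^ alpha - 1)) / (2 ^+ 8 * expR (- u) ^+ 2) <= beta ->
  let g := u * ln u in
  let p := 2 / (1 - 2 * alpha) in
  let D := 1 * expR g * (expR u `^ p) in
  let lo := 1 * (u `^ (- p)) * (ln u `^ (- (1 / (1 - 2 * alpha)))) in
  let hi := c2 * u * ln u in
  exists A : set T, [/\ measurable A, ((1 - expR (- g))%:E <= P A)%E &
    forall w, A w -> exists l : R,
      (fun n : nat => gibbs_prob alpha J1 (expR (- u)) beta (fun i => h i w) n plus_bc
                         (runs_ok D lo hi (expR (- u) `^ p))) @ \oo --> l
      /\ 1 - expR (- g) <= l].
Proof.
move=> a12 hJ; have /andP[a0 a1] := a12.
have a01 : 0 <= alpha < 1 by lra.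
have b0 : 0 < 1 - 2 * alpha by lra.
have zp : 0 < 1 - 2 * (2 `^ alpha - 1) by apply: zeta_gt0; lra.
set zeta := 1 - 2 * (2 `^ alpha - 1) in zp *.
have iap : 0 < alpha^-1 by rewrite invr_gt0.
have i1p : 0 < (1 - alpha)^-1 by rewrite invr_gt0; lra.
have J1p : 2 <= J1.
  by apply: le_trans hJ; rewrite lerDl mulr_ge0 ?(ltW i1p) //; lra.
pose cg := zeta / (alpha * (1 - alpha)).
have cg0 : 0 < cg by rewrite divr_gt0 // mulr_gt0 //; lra.
pose p := 2 / (1 - 2 * alpha).
have p0 : 0 < p by rewrite divr_gt0.
have pb : p * (1 - 2 * alpha) = 2 by rewrite /p divfK // gt_eqF.
(* Chosen so that, with [M = e^((p+2) g)] below, [M^4 e^(- Q g) = e^(-2 g)]. *)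
pose Q := 4 * p + 10.
pose CJ := 2 * (J1 + (3 + alpha^-1) / (1 - alpha)) + 1.
have CJ1 : 1 <= CJ.
  have : 0 <= (3 + alpha^-1) / (1 - alpha) by rewrite mulr_ge0 ?(ltW i1p) //; lra.
  by rewrite /CJ; lra.
pose kap := ln (2 * CJ).
have kap0 : 0 <= kap by rewrite ln_ge0 //; lra.
pose K0 := expR (p * kap).
have K01 : 1 <= K0 by rewrite -[leLHS]expR0 ler_expR mulr_ge0 // ltW.
have QE : Q = 4 * p + 10 by [].
have CJE : CJ = 2 * (J1 + (3 + alpha^-1) / (1 - alpha)) + 1 by [].
have kapE : 2 * CJ = expR kap by rewrite /kap lnK // posrE; lra.
have K0E : K0 = expR (p * kap) by [].
have nearG (L q : nat) : (0 < L)%N -> (L <= q)%N ->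
    Cut (Jint alpha J1) L q - 2 * Cut (Jint alpha J1) L L <= - (1 + cg * L%:R `^ alpha).
  exact: near_far_pos.
clearbody Q CJ kap K0 cg.
(* Each summand is one of the lower bounds used on [u]. The factor 22 comes from [K <= 11 Q g] and
   [ell <= 2 K0 e^(p u)]. *)
exists (expR 1 + 8 * Q / cg ^+ 2 + 16 * (256 * Q / zeta) + (44 * Q * K0 + 33)), (22 * Q * K0).
have Q0 : 10 <= Q by rewrite QE; lra.
have QK0 : 10 <= Q * K0 by rewrite -[leLHS]mulr1; apply: ler_pM.
split; first by move: QK0; clear; lra.
move=> d T P h iid u beta Uu hbeta; cbv zeta; rewrite -/p.
set g := u * ln u; set D := 1 * expR g * _; set lo := 1 * _ * _.
set hi := 22 * Q * K0 * u * ln u.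
have [ue ucg uz uK] : [/\ expR 1 <= u, 8 * Q / cg ^+ 2 <= u, 16 * (256 * Q / zeta) <= u
     & 44 * Q * K0 + 33 <= u].
  have Qp : 0 <= Q by apply: le_trans Q0.
  have h1 : 0 <= 8 * Q / cg ^+ 2 by rewrite divr_ge0 ?sqr_ge0 // mulr_ge0.
  have h2 : 0 <= 256 * Q / zeta by rewrite mulr_ge0 ?invr_ge0 ?(ltW zp) // mulr_ge0 ?ler0n.
  have h3 := expR_ge0 (1 : R).
  by split; move: Uu h1 h2 h3 QK0; clear; lra.
have u33 : 33 <= u by move: uK QK0; clear; lra.
have u1 : 1 <= u by move: u33; clear; lra.
have u0 : 0 < u by apply: lt_le_trans u1.
pose y := ln u.
have uE : u = expR y by rewrite /y lnK.
have y1 : 1 <= y by rewrite -ler_expR -uE.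
have y0 : 0 < y by apply: lt_le_trans y1.
have gE : g = u * y by [].
have yu : y <= u by exact: ln_le.
pose z := ln y.
have yE : y = expR z by rewrite /z lnK.
have z0 : 0 <= z by rewrite ln_ge0.
have ug : u <= g by rewrite gE ler_peMr // ltW.
have g0 : 33 <= g by apply: le_trans ug.
have g00 : 0 <= g by apply: le_trans g0.
have pu0 : 0 <= p * u by rewrite mulr_ge0 // ltW.
have pu : p * u <= p * g by rewrite ler_pM2l.
have scE : expR (- u) `^ p = expR (- (p * u)).
  by rewrite -expRM; congr expR; ring.
have loE : lo = expR (- (p * y) - p / 2 * z).
  rewrite /lo mul1r {1}uE -/y {2}yE -!expRM -expRD; congr expR.
  by rewrite /p; field; rewrite gt_eqF.
have DE : D = expR (g + p * u).
  by rewrite /D mul1r -expRM -expRD; congr expR; ring.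
have losc : lo / expR (- (p * u)) = expR (p * u - p * y - p / 2 * z).
  by rewrite loE -expRN -expRD; congr expR; ring.
pose lmin := Num.truncn (lo / expR (- (p * u))).
have lminle : lmin%:R <= lo / expR (- (p * u)).
  have : 0 <= lo / expR (- (p * u)) by rewrite losc expR_ge0.
  by move=> /truncn_itv /andP[].
have ellp : 1 <= K0 * expR (p * u).
  by rewrite K0E -expRD -[leLHS]expR0 ler_expR addr_ge0 // mulr_ge0 // ltW.
pose ell := (Num.truncn (K0 * expR (p * u))).+1.
have [ell1 ell2] : K0 * expR (p * u) <= ell%:R /\ ell%:R <= 2 * (K0 * expR (p * u)).
  exact: truncn_S_bounds.
pose x := Q * g.
have x1 : 1 <= x by rewrite /x; move: Q0 g0; clear; nra.
pose K := (Num.truncn (10 * x)).+1.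
have [K1 K2] : 10 * x <= K%:R /\ K%:R <= 11 * x by exact: block_count_bounds.
have D1 : 1 <= D by rewrite DE -[leLHS]expR0 ler_expR addr_ge0.
pose v := (Num.truncn (D / 2)).+1.
have v2 : v%:R <= 2 * D by exact: half_truncn_le.
(* The largest scale is [D = e^(g + p u)] with [p u <= p g]; one more [e^g] absorbs the
   constants. *)
pose M := expR ((p + 2) * g).
have Kell : (K * ell)%:R <= 22 * Q * K0 * g * expR (p * u).
  rewrite natrM; apply: (@le_trans _ _ ((11 * x) * (2 * (K0 * expR (p * u))))).
    by apply: ler_pM.
  by rewrite /x le_eqVlt; apply/orP; left; apply/eqP; ring.
have ueg : u <= expR g by apply: le_trans (le_expR u) _; rewrite ler_expR.
have eg1 : 1 <= expR g by rewrite -[leLHS]expR0 ler_expR.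
have pe0 := expR_gt0 (p * u).
have MK (C : R) : 0 <= C -> C <= expR g * expR g -> C * expR (p * u) <= M.
  move=> C0 Cg; have -> : M = expR g * expR g * expR (p * g).
    by rewrite /M -!expRD; congr expR; ring.
  by apply: ler_pM; rewrite ?expR_ge0 // ler_expR.
apply: (@runs_ok_typical R alpha J1 (expR (- u)) beta D lo hi _
   (J1 + (3 + antideriv alpha ell%:R) / (1 - alpha)) x _ M lmin ell K v
   (fun L => 1 + cg * L%:R `^ alpha) d T P h a01).
- by apply: le_trans J1p.
- exact: expR_gt0.
- move=> L; rewrite scE => hL; apply: truncn_gt.
  by rewrite ltr_pdivlMr ?expR_gt0 // mulrC.
- move=> L; rewrite scE => hL.
  rewrite -(ler_nat R); apply: le_trans Kell _.
  have : hi * expR (p * u) <= expR (- (p * u)) * L%:R * expR (p * u).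
    by rewrite ler_pM2r // ltW.
  rewrite [leRHS]mulrAC -expRD addNr expR0 mul1r; apply: le_trans.
  by rewrite /hi gE le_eqVlt; apply/orP; left; apply/eqP; rewrite /y; ring.
- by move=> z'; apply: centered_bound; apply: le_trans D1.
- by [].
- exact: nearG.
- by move=> L _; rewrite lerDl mulr_ge0 ?powR_ge0 // ltW.
- by move=> q; apply: Cut_le => //; apply: le_trans J1p.
- move=> L /andP[L0 Ll].
  pose s := ln (L%:R : R).
  have Lp : (0 : R) < L%:R by rewrite ltr0n.
  have LE : L%:R = expR s by rewrite /s lnK.
  have sle : s <= p * u - p * y - p / 2 * z.
    by rewrite -ler_expR -LE -losc; apply: le_trans lminle; rewrite ler_nat.
  rewrite LE -expRM /x gE; apply: (small_field_pos cg0 b0 pb uE yE sle).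
  by move: ucg; rewrite ler_pdivrMr ?exprn_gt0 // [u * _]mulrC.
- pose s := ln (ell%:R : R).
  have lp : (0 : R) < ell%:R by rewrite ltr0n.
  have LE : ell%:R = expR s by rewrite /s lnK.
  have s1 : p * kap + p * u <= s by rewrite -ler_expR -LE expRD -K0E.
  have s0 : 0 <= s by apply: le_trans s1; rewrite addr_ge0 // mulr_ge0 // ltW.
  rewrite /antideriv (gt_eqF a0) LE sqrt_expR -expRM.
  apply: (large_field_pos a0 b0 _ s0 pb s1); first by apply: le_trans J1p.
  by rewrite -kapE CJE.
- exact: K1.
- apply: (le_trans lminle); rewrite losc; apply: le_trans (MK 1 _ _) => //; last first.
    by rewrite -[leLHS]mulr1; apply: ler_pM.
  rewrite mul1r ler_expR.
  by have := mulr_ge0 (ltW p0) (ltW y0); have := mulr_ge0 (ltW p0) z0; clear; lra.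
- apply: (le_trans ell2); rewrite mulrA; apply: MK; first by move: K01; clear; lra.
  apply: (@le_trans _ _ (expR g * 1)); last by rewrite ler_pM2l ?expR_gt0.
  rewrite mulr1; apply: le_trans ueg; apply: le_trans uK.
  by move: Q0 K01; clear; nra.
- apply: (le_trans Kell); apply: MK.
    by rewrite mulr_ge0 //; move: QK0; clear; lra.
  apply: ler_pM => //; [by move: QK0; clear; lra| |exact: le_expR].
  by apply: le_trans ueg; apply: le_trans uK; move: QK0; clear; lra.
- apply: (le_trans v2); rewrite DE expRD mulrA; apply: MK; first by rewrite mulr_ge0 ?expR_ge0.
  rewrite ler_pM2r ?expR_gt0 //; apply: le_trans ueg; move: u33; clear; lra.
- apply: le_trans (le_expR _); apply: (le_trans g0); rewrite ler_peMl //.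
  by move: p0; clear; lra.
- have -> : M ^+ 4 = expR ((p + 2) * g * 4%:R) by rewrite expRM_natr.
  by rewrite -expRD ler_expR /x QE; move: g00; clear; lra.
- by apply: le_trans x1.
- apply: le_trans hbeta; apply: (temperature_bound zp u1 uz).
  by rewrite /x gE expr2 ler_pM2l ?ler_pM2l //; apply: lt_le_trans Q0.
- exact: iid.
Qed.

End Asymptotics.

(** * The case [alpha = 0] *)

Section AsymptoticsZero.
Variable R : realType.
Implicit Types (u x y : R).

(** For [s <= u] the factor [e^(2u - s) >= e^u] already exceeds [(u/2)^2]; for [s > u] the gain
    [(1 + s)^2 >= u^2] suffices, where only [s <= 2 u] keeps the exponential at least 1. *)
Lemma small_field_zero (Q u s : R) : 0 <= Q -> 32 <= u -> 32 * Q <= u -> 0 <= s <= 2 * u ->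
  Q * u <= ((1 + s) / expR (- u)) ^+ 2 / (8 * expR s).
Proof.
move=> Q0 u32 uQ /andP[s0 su].
have -> : ((1 + s) / expR (- u)) ^+ 2 / (8 * expR s) = (1 + s) ^+ 2 * expR (2 * u - s) / 8.
  rewrite -expRN opprK expRD expRN.
  have -> : expR (2 * u) = expR u ^+ 2 by rewrite expr2 -expRD; congr expR; ring.
  by field; rewrite gt_eqF // expR_gt0.
rewrite ler_pdivlMr //.
have [hs|hs] := lerP s u.
  have e1 : (u / 2) ^+ 2 <= expR u.
    have -> : u = 2 * (u / 2) by field.
    have := @sqr_le_expR R 1 (u / 2); rewrite mul1r.
    have -> : 2 * (u / 2) / 2 = u / 2 by field.
    by apply; lra.
  have e2 : expR u <= expR (2 * u - s) by rewrite ler_expR; lra.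
  have e3 : 1 <= (1 + s) ^+ 2 by nra.
  have := ler_pM ler01 (sqr_ge0 (u / 2)) e3 (le_trans e1 e2).
  by apply: le_trans; nra.
have e1 : 1 <= expR (2 * u - s) by rewrite -[leLHS]expR0 ler_expR; lra.
have e3 : u ^+ 2 <= (1 + s) ^+ 2 by nra.
have := ler_pM (sqr_ge0 u) ler01 e3 e1.
by apply: le_trans; nra.
Qed.

(* As for alpha > 0, except that flipping a block of length ell now costs about log ell, so that
   the blocks have length ell ~ (q u)^2 theta^(-2) with u = log(1/theta). *)
Lemma typical_zero (J1 : R) : 4 + 2 * ln 2 <= J1 ->
  exists U c2 : R, 0 < c2 /\
  forall (d : measure_display) (T : measurableType d) (P : probability T R) (h : int -> T -> R),
  iid_sym_signs P h -> forall u beta : R, U <= u ->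
  (1 - 2 * (2 `^ 0 - 1)) / (2 ^+ 8 * expR (- u) ^+ 2) <= beta ->
  let g := ln (u * expR u) in
  let D := 1 * expR g * expR (- u) ^- 2 in
  let hi := c2 * u ^+ 3 in
  exists A : set T, [/\ measurable A, ((1 - expR (- g))%:E <= P A)%E &
    forall w, A w -> exists l : R,
      (fun n : nat => gibbs_prob 0 J1 (expR (- u)) beta (fun i => h i w) n plus_bc
                         (runs_ok D 1 hi (expR (- u) ^+ 2))) @ \oo --> l
      /\ 1 - expR (- g) <= l].
Proof.
move=> hJ.
have a01 : 0 <= (0 : R) < 1 by lra.
have J1p : 0 <= J1 by apply: le_trans hJ; rewrite addr_ge0 // mulr_ge0 // ln_ge0 // ler1n.
have zp : 0 < 1 - 2 * (2 `^ 0 - 1) :> R by apply: zeta_gt0; lra.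
set zeta := 1 - 2 * (2 `^ 0 - 1) in zp *.
(* With [M = e^(6u)] below, [M^4 e^(-26 u) = e^(-2u)], and [g <= 2 u]. *)
have [Q QE] : exists Q : R, Q = 26 by exists 26.
(* With [sqrt ell >= q u e^u] the field term [theta * sqrt ell / 2] is at least [11 u], which covers
   [2 J1 + 7 <= u] and [2 ln ell <= 10 u]. *)
have [q qE] : exists q : R, q = 22 by exists 22.
pose c2 := 22 * Q * q ^+ 2.
have Q0 : 1 <= Q by rewrite QE; lra.
have q0 : 1 <= q by rewrite qE; lra.
have q21 : 1 <= q ^+ 2 by nra.
have c20 : 22 * q ^+ 2 <= c2 by rewrite /c2; nra.
exists (32 + 32 * Q + (2 * J1 + 7) + c2 + 16 * (256 * Q / zeta)), c2.
split; first by move: c20 q21; clear; lra.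
move=> d T P h iid u beta Uu hbeta; cbv zeta.
set g := ln (u * expR u); set D := 1 * expR g * _; set hi := c2 * u ^+ 3.
have [u32 uQ uJ uc uz] : [/\ 32 <= u, 32 * Q <= u, 2 * J1 + 7 <= u, c2 <= u
    & 16 * (256 * Q / zeta) <= u].
  have h2 : 0 <= 256 * Q / zeta.
    by rewrite mulr_ge0 ?invr_ge0 ?(ltW zp) // mulr_ge0 ?ler0n // (le_trans ler01).
  by split; move: Uu h2 J1p Q0 c20 q21; clear; lra.
have u1 : 1 <= u by move: u32; clear; lra.
have u0 : 0 < u by apply: lt_le_trans u1.
pose y := ln u.
have uE : u = expR y by rewrite /y lnK.
have yu : y <= u by exact: ln_le.
have y0 : 0 <= y by rewrite ln_ge0.
have gE : g = y + u by rewrite /g {1}uE -expRD expRK.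
have ueu : u <= expR u by exact: le_expR.
have sc0 : 0 < expR (- u) ^+ 2 by rewrite exprn_gt0 // expR_gt0.
have scV : (expR (- u) ^+ 2)^-1 = expR (2 * u).
  by rewrite expr2 -expRD -expRN; congr expR; ring.
have DE : D = expR (g + 2 * u) by rewrite /D mul1r scV -expRD.
(* The lower bound is 1, so a short run has length below [theta^(-2) = e^(2u)]. *)
pose lmin := Num.truncn (expR (2 * u)).
have lminle : lmin%:R <= expR (2 * u) by have /andP[] := truncn_itv (expR_ge0 (2 * u)).
have e2E : expR (2 * u) = expR u ^+ 2 by rewrite expr2 -expRD; congr expR; ring.
have que : 1 <= q * u * expR u.
  rewrite -[leLHS]mulr1; apply: ler_pM => //; last by apply: le_trans ueu.
  by rewrite -[leLHS]mulr1; apply: ler_pM.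
pose ell := (Num.truncn ((q * u * expR u) ^+ 2)).+1.
have [ell1 ell2] : (q * u * expR u) ^+ 2 <= ell%:R /\ ell%:R <= 2 * (q * u * expR u) ^+ 2.
  by apply: truncn_S_bounds; rewrite exprn_ege1.
pose x := Q * u.
have x1 : 1 <= x by rewrite -[leLHS]mulr1; apply: ler_pM.
pose K := (Num.truncn (10 * x)).+1.
have [K1 K2] : 10 * x <= K%:R /\ K%:R <= 11 * x by exact: block_count_bounds.
have D1 : 1 <= D by rewrite DE gE -[leLHS]expR0 ler_expR; move: y0 u0; clear; lra.
pose v := (Num.truncn (D / 2)).+1.
have v2 : v%:R <= 2 * D by exact: half_truncn_le.
pose M := expR (6 * u).
have ME k : (k <= 6)%N -> expR u ^+ k <= M.
  move=> k6; rewrite -expRM_natl ler_expR ler_pM2r //.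
  by rewrite (ler_nat R k 6).
have eu1 : 1 <= expR u by apply: le_trans ueu.
have eu0 : 0 <= expR u by exact: expR_ge0.
have Kell : (K * ell)%:R <= c2 * u ^+ 3 * expR (2 * u).
  rewrite natrM; apply: (@le_trans _ _ ((11 * x) * (2 * (q * u * expR u) ^+ 2))).
    by apply: ler_pM.
  by rewrite /x /c2 e2E le_eqVlt; apply/orP; left; apply/eqP; ring.
have ell5 : ell%:R <= expR u ^+ 5.
  apply: (le_trans ell2).
  have -> : 2 * (q * u * expR u) ^+ 2 = (2 * q ^+ 2) * (u ^+ 2 * expR u ^+ 2) by ring.
  have -> : expR u ^+ 5 = expR u * (expR u ^+ 2 * expR u ^+ 2) by ring.
  apply: ler_pM; [by rewrite mulr_ge0 ?sqr_ge0|by rewrite mulr_ge0 ?sqr_ge0| |].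
    by apply: le_trans ueu; apply: le_trans uc; apply: le_trans c20; move: q21; clear; lra.
  by rewrite ler_wpM2r ?sqr_ge0 // lerXn2r ?nnegrE // ltW.
apply: (@runs_ok_typical R 0 J1 (expR (- u)) beta D 1 hi _
   (J1 + (3 + antideriv 0 ell%:R) / (1 - 0)) x _ M lmin ell K v
   (fun L => 1 + ln L%:R) d T P h a01 J1p).
- exact: expR_gt0.
- move=> L hL; apply: truncn_gt.
  by rewrite -scV -[ltRHS]mul1r ltr_pdivlMr // mulrC.
- move=> L hL.
  rewrite -(ler_nat R); apply: le_trans Kell _.
  by rewrite -scV ler_pdivrMr // [L%:R * _]mulrC ltW.
- by move=> z'; apply: centered_bound; apply: le_trans D1.
- by [].
- by move=> L q' L0 Lq; exact: near_far_zero.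
- by move=> L L0; rewrite lerDl ln_ge0 // ler1n.
- by move=> q'; exact: Cut_le.
- move=> L /andP[L0 Ll].
  pose s := ln (L%:R : R).
  have Lp : (0 : R) < L%:R by rewrite ltr0n.
  have LE : L%:R = expR s by rewrite /s lnK.
  rewrite LE expRK; apply: small_field_zero => //; first exact: le_trans Q0.
  rewrite ln_ge0 ?ler1n //= -ler_expR -LE; apply: le_trans lminle.
  by rewrite ler_nat.
- rewrite /antideriv eqxx subr0 divr1.
  have l5 : ln (ell%:R : R) <= 5 * u.
    rewrite -ler_expR lnK ?posrE ?ltr0n //; apply: (le_trans ell5).
    by rewrite -expRM_natl.
  apply: (@le_trans _ _ (11 * u)); first by move: l5 uJ; clear; lra.
  have : q * u * expR u <= Num.sqrt ell%:R.
    rewrite -[leLHS]ger0_norm; last by apply: le_trans que.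
    by rewrite -sqrtr_sqr ler_wsqrtr.
  move=> /(ler_wpM2l (expR_ge0 (- u))).
  have -> : expR (- u) * (q * u * expR u) = q * u.
    by rewrite expRN; field; rewrite gt_eqF // expR_gt0.
  by rewrite qE mulrA; lra.
- exact: K1.
- by apply: (le_trans lminle); rewrite e2E ME.
- by apply: (le_trans ell5); rewrite ME.
- apply: (le_trans Kell); apply: le_trans (ME 6 isT); rewrite e2E.
  have -> : expR u ^+ 6 = expR u * expR u ^+ 3 * expR u ^+ 2 by ring.
  have c00 : 0 <= c2 by move: c20 q21; clear; lra.
  rewrite ler_wpM2r ?sqr_ge0 //; apply: ler_pM => //; first by rewrite exprn_ge0 // ltW.
    exact: le_trans ueu.
  by rewrite lerXn2r ?nnegrE // ltW.
- apply: (le_trans v2); apply: le_trans (ME 5 isT); rewrite DE gE.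
  have -> : expR (y + u + 2 * u) = u * (expR u * expR u ^+ 2) by rewrite !expRD -uE e2E; ring.
  have -> : expR u ^+ 5 = expR u * expR u * (expR u * expR u ^+ 2) by ring.
  rewrite mulrA ler_wpM2r ?mulr_ge0 ?sqr_ge0 //; apply: ler_pM => //; first exact: ltW.
  by apply: le_trans ueu; move: u32; clear; lra.
- by apply: le_trans (le_expR _); move: u32; clear; lra.
- have -> : M ^+ 4 = expR (6 * u * 4%:R) by rewrite expRM_natr.
  by rewrite -expRD ler_expR /x QE gE; move: yu; clear; lra.
- by apply: le_trans x1.
- apply: le_trans hbeta; apply: (temperature_bound zp u1 uz).
  rewrite /x ler_wpM2l ?(le_trans ler01) // expr2 ler_peMr // ltW //.
- exact: iid.
Qed.

End AsymptoticsZero.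

Theorem theorem2p1 (R : realType) (alpha : R) :
  0 <= alpha < 2^-1 ->
  let zeta := 1 - 2 * (2 `^ alpha - 1) in
  exists J0 : R, forall J1 : R, J0 <= J1 ->
  exists theta0 beta0 c0 c1 c2 : R,
    [/\ 0 < theta0, 0 < c0, 0 < c1, 0 < c2 &
    forall (d : measure_display) (T : measurableType d) (P : probability T R)
           (h : int -> T -> R),
    iid_sym_signs P h ->
    forall theta beta : R,
      0 < theta <= theta0 -> beta0 < beta -> zeta / (2 ^+ 8 * theta ^+ 2) <= beta ->
      (0 < alpha ->
        let g := ln (theta^-1) * ln (ln (theta^-1)) in
        let p := 2 / (1 - 2 * alpha) in
        let D := c0 * expR g * (theta^-1 `^ p) in
        let lo := c1 * (ln (theta^-1) `^ (- p)) * (ln (ln (theta^-1)) `^ (- (1 / (1 - 2 * alpha)))) in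
        let hi := c2 * ln (theta^-1) * ln (ln (theta^-1)) in
        exists A : set T, [/\ measurable A, ((1 - expR (- g))%:E <= P A)%E &
          forall w, A w -> exists l : R,
            (fun n : nat => gibbs_prob alpha J1 theta beta (fun i => h i w) n plus_bc
                               (runs_ok D lo hi (theta `^ p))) @ \oo --> l
            /\ 1 - expR (- g) <= l])
      /\
      (alpha = 0 ->
        let g := ln (ln (theta^-1) / theta) in
        let D := c0 * expR g * theta ^- 2 in
        let lo := c1 in
        let hi := c2 * ln (theta^-1) ^+ 3 in
        exists A : set T, [/\ measurable A, ((1 - expR (- g))%:E <= P A)%E &
          forall w, A w -> exists l : R,
            (fun n : nat => gibbs_prob alpha J1 theta beta (fun i => h i w) n plus_bc
                               (runs_ok D lo hi (theta ^+ 2))) @ \oo --> l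
            /\ 1 - expR (- g) <= l])].
Proof.
move=> a12 zeta.
have u_of (theta U : R) : 0 < theta <= expR (- U) -> exists2 u, theta = expR (- u) & U <= u.
  move=> /andP[t0 tU]; exists (- ln theta); first by rewrite opprK lnK.
  by rewrite lerNr -ler_expR lnK.
have inv_expR (u : R) : (expR (- u))^-1 = expR u by rewrite -expRN opprK.
have [a0|an0] := eqVneq alpha 0.
  rewrite {}/zeta {alpha}a0 in a12 *.
  exists (4 + 2 * ln 2) => J1 hJ.
  have [U [c2 [c20 typ]]] := typical_zero hJ.
  exists (expR (- U)), 0, 1, 1, c2; split; rewrite ?expR_gt0 //.
  move=> d T P h iid theta beta /u_of[u -> Uu] _ hbeta.
  split; first by rewrite ltxx.
  by move=> _; rewrite inv_expR expRK; exact: typ.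
have a0 : 0 < alpha < 2^-1 by move: a12 an0; case: ltgtP => //=; lra.
exists (2 + (2 + alpha^-1) / (1 - alpha)) => J1 hJ.
have [U [c2 [c20 typ]]] := typical_pos a0 hJ.
(* In terms of [u = log(1/theta)], [theta <= e^(-U)] is [U <= u]. The constants of the lower bound
   were absorbed by a large [u], whence [c1 = 1]. *)
exists (expR (- U)), 0, 1, 1, c2; split; rewrite ?expR_gt0 //.
move=> d T P h iid theta beta /u_of[u -> Uu] _ hbeta.
split; last by move=> e; rewrite e eqxx in an0.
by move=> _; rewrite inv_expR expRK; exact: typ.
Qed.
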